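(* Let $\mathcal I$ be a semi-ideal on a compact metrizable space $Z=\bigcup\mathcal I$ and let $\Gamma,\Lambda$ be two pointclasses such that the triple $(\mathcal I,\Gamma,\Lambda)$ has the property $\mathbf{(H)}$. Let $X$ be a Polish group containing a topological copy of the compact space $Z$. If $X$ is not locally compact, then there exists a Haar-$1$ (and hence Haar-$\mathcal I$) set $E\in\Gamma(X)$ which cannot be enlarged to a Haar-$\mathcal I$ set $H\in\Lambda(X)$ (that is, no Haar-$\mathcal I$ set $H\in\Lambda(X)$ contains $E$).
   Context: All groups are Abelian, written additively; a Polish group is a topological group whose underlying space is Polish. A semi-ideal on a set is a nonempty family of subsets closed under taking subsets. For a semi-ideal $\mathcal I$ on a nonempty compact space $Z=\bigcup\mathcal I$, a subset $A$ of a Polish group $X$ is Haar-$\mathcal I$ if there is a continuous map $f:Z\to X$ with $f^{-1}(A+x)\in\mathcal I$ for all $x\in X$. A subset $A\subset X$ is Haar-$1$ if there is a continuous map $f:2^\omega\to X$ with $|f^{-1}(A+x)|\le 1$ for all $x\in X$. $C(Z,X)$ is the Polish space of continuous maps $Z\to X$ with the compact-open topology. A pointclass $\Gamma$ assigns to each Polish space $X$ a family $\Gamma(X)$ of subsets of $X$ such that: for every continuous map $f:X\to Y$ between Polish spaces and every $B\in\Gamma(Y)$ we have $f^{-1}(B)\in\Gamma(X)$; and for every Polish space $X$, $\emptyset,X\in\Gamma(X)$ and $A\cap B,\,A\cup B\in\Gamma(X)$ for all $A,B\in\Gamma(X)$. The dual pointclass is $\Gamma^c(X)=\{A\subset X:X\setminus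 A\in\Gamma(X)\}$. A family $\mathcal I$ of subsets of a Polish space $Z$ is $\Lambda$-on-$\Gamma$ if for any Polish space $Y$ and any $A\in\Gamma(Z\times Y)$ we have $\{y\in Y:A_y\in\mathcal I\}\in\Lambda(Y)$, where $A_y=\{z\in Z:(z,y)\in A\}$. For a semi-ideal $\mathcal I$ on a compact metrizable space $Z=\bigcup\mathcal I$ and pointclasses $\Gamma,\Lambda$, the triple $(\mathcal I,\Gamma,\Lambda)$ has the property $\mathbf{(H)}$ if: (H1) for any $A\in\mathcal I$ the set $Z\setminus A$ does not belong to $\mathcal I$; (H2) for any Polish space $P$ there is a set $U\in\Gamma(2^\omega\times P)$ which is $\Lambda^c(P)$-universal: for every $A\in\Lambda^c(P)$ there is $x\in 2^\omega$ with $U_x:=\{p\in P:(x,p)\in U\}=A$; (H3) $\mathcal I$ is $\Gamma^c$-on-$\Gamma$; (H4) for any Polish spaces $X,Y$, if $A\in\Gamma(C(Z,X)\times Y\times X)$ is such that for every $(h,y)\in C(Z,X)\times Y$ the section $A_{(h,y)}:=\{g\in X:(h,y,g)\in A\}$ is either empty or satisfies $h^{-1}(A_{(h,y)})\notin\mathcal I$, then $A$ has a uniformization $\phi\in\Gamma(C(Z,X)\times Y\times X)$, i.e. $\phi\subset A$ and for any $(h,y)$ with $A_{(h,y)}\neq\emptyset$ the section $\phi_{(h,y)}$ is a singleton; (H5) for any Borel injection $f:X\to Y$ between Polish spaces, $\{f(A):A\in\Gamma(X)\}\subset\Gamma(Y)$. *)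

(* Defs.v *)
From HB Require Import structures.
From mathcomp Require Import all_boot all_order all_algebra.
From mathcomp Require Import all_classical all_reals all_analysis.

Set Implicit Arguments.
Unset Strict Implicit.
Unset Printing Implicit Defensive.

Import Order.TTheory GRing.Theory Num.Theory.
Local Open Scope classical_set_scope.
Local Open Scope ring_scope.

Definition is_metric (R : realType) (T : Type) (d : T -> T -> R) : Prop :=
  [/\ forall x, d x x = 0,
      forall x y, d x y = 0 -> x = y,
      forall x y, d x y = d y x
    & forall x y z, d x z <= d x y + d y z].

(* [d] is a metric inducing the given topology of [T]. *)
Definition metrizes (R : realType) (T : topologicalType) (d : T -> T -> R) :
    Prop :=
  is_metric d /\
  forall (x : T) (A : set T),
    nbhs x A <-> exists2 e : R, 0 < e & [set y | d x y < e] `<=` A.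

Definition metric_complete (R : realType) (T : topologicalType)
    (d : T -> T -> R) : Prop :=
  forall u : nat -> T,
    (forall e : R, 0 < e ->
      exists N, forall m n, (N <= m)%N -> (N <= n)%N -> d (u m) (u n) < e) ->
    exists l : T, u @ \oo --> l.

Definition metrizable (R : realType) (T : topologicalType) : Prop :=
  exists d : T -> T -> R, metrizes d.

(* The empty space is Polish under this definition. *)
Definition polish (R : realType) (T : topologicalType) : Prop :=
  (exists D : set T, countable D /\ dense D) /\
  (exists d : T -> T -> R, metrizes d /\ metric_complete d).

Definition topological_embedding (S T : topologicalType) (e : S -> T) : Prop :=
  [/\ injective e, continuous e
    & forall U : set S, open U -> exists2 V : set T, open V & e @^-1` V = U].

Definition borel_map (S T : topologicalType) (f : S -> T) : Prop :=
  forall B : set T, <<s @open T >> B -> <<s @open S >> (f @^-1` B).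

(* A family of sets on every topological space, of which only the values at
   Polish spaces matter: every condition below is restricted to those. *)
Definition setclass : Type := forall X : topologicalType, set (set X).

Definition is_pointclass (R : realType) (G : setclass) : Prop :=
  (forall (X Y : topologicalType) (f : X -> Y) (B : set Y),
     polish R X -> polish R Y -> continuous f -> G Y B -> G X (f @^-1` B)) /\
  (forall X : topologicalType, polish R X ->
     [/\ G X set0, G X setT
       & forall A B : set X, G X A -> G X B ->
           G X (A `&` B) /\ G X (A `|` B)]).

Definition dual_class (G : setclass) : setclass :=
  fun X => [set A : set X | G X (~` A)].

Definition semi_ideal (Z : Type) (I : set (set Z)) : Prop :=
  I !=set0 /\ forall A B : set Z, A `<=` B -> I B -> I A.

Definition haar (Z : topologicalType) (I : set (set Z))
    (X : topologicalZmodType) (A : set X) : Prop :=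
  exists f : Z -> X, continuous f /\
    forall x : X, I (f @^-1` [set a + x | a in A]).

Definition haar1 (X : topologicalZmodType) (A : set X) : Prop :=
  exists f : cantor_space -> X, continuous f /\
    forall x : X, is_subset1 (f @^-1` [set a + x | a in A]).

Definition class_on_class (R : realType) (L G : setclass)
    (Z : topologicalType) (I : set (set Z)) : Prop :=
  forall (Y : topologicalType) (A : set (Z * Y)), polish R Y ->
    G _ A -> L Y [set y | I (ysection A y)].

Section PropertyH.
(* The topology of [continuousType Z X] is the compact-open one. *)
Import ArrowAsCompactOpen.

Definition has_uniformization (G : setclass) (Z X Y : topologicalType)
    (A : set (continuousType Z X * Y * X)) : Prop :=
  exists phi : set (continuousType Z X * Y * X),
    [/\ G _ phi, phi `<=` A
      & forall hy : continuousType Z X * Y, xsection A hy !=set0 ->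
          exists g : X, xsection phi hy = [set g]].

Record propertyH (R : realType) (Z : topologicalType) (I : set (set Z))
    (G L : setclass) : Prop := PropertyH {
  propertyH1 : forall A : set Z, I A -> ~ I (~` A);
  propertyH2 : forall P : topologicalType, polish R P ->
    exists U : set (cantor_space * P), G _ U /\
      forall A : set P, dual_class L A ->
        exists x : cantor_space, xsection U x = A;
  propertyH3 : class_on_class R (dual_class G) G I;
  propertyH4 : forall X Y : topologicalType, polish R X -> polish R Y ->
    forall A : set (continuousType Z X * Y * X), G _ A ->
      (forall (h : continuousType Z X) (y : Y),
         xsection A (h, y) = set0 \/ ~ I (h @^-1` xsection A (h, y))) ->
      has_uniformization G A;
  propertyH5 : forall (X Y : topologicalType) (f : X -> Y) (A : set X),
    polish R X -> polish R Y -> injective f -> borel_map f ->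
    G X A -> G Y (f @` A)
}.

End PropertyH.

(* Main.v *)
Require Import Defs.
From HB Require Import structures.
From mathcomp Require Import all_boot all_order all_algebra.
From mathcomp Require Import all_classical all_reals all_analysis.
From mathcomp Require Import lra.

Set Implicit Arguments.
Unset Strict Implicit.
Unset Printing Implicit Defensive.

Import Order.TTheory GRing.Theory Num.Theory.
Local Open Scope classical_set_scope.
Local Open Scope ring_scope.

(** The set [E] is built by diagonalizing over all pairs [(h, y)], where
    [h : Z -> X] is continuous and [y] is a point of the Cantor space.

    Suppose that a translation vector [t (h, y)] is attached to every such pair,
    and let [U] be universal for the dual class of [Lam] on (Cantor space) * [X].
    Whenever the set of [g] in [h @` setT] with [(y, (y, g))] in [U] is large
    along [h], meaning that its preimage under [h] is outside the ideal, the
    uniformization property picks one such [g], and [g + t (h, y)] is put into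
    [E].  Let [H] contain [E], belong to [Lam], and be Haar-[I] as witnessed by
    [h].  As [t (h, -)] is continuous, the set of all [(y, g)] with
    [g + t (h, y)] outside [H] is in the dual class, so it is the section of [U]
    at some [y].  For this [y] the admissible [g] are those with [g + t (h, y)]
    outside [H]; they are large along [h], because the translates of [H] are
    small along [h].  Hence some point of [E] is outside [H], a contradiction.

    The remaining properties of [E] come from the choice of [t]: for a compact
    set [L] fixed in advance, the sets [h @` setT + L + t (h, y)] are pairwise
    disjoint ([compact_translates]).  Since [E] has at most one point
    in each [h @` setT + t (h, y)], no difference of two points of [E] is a
    nonzero difference of two points of [L]; so every translate of [E] meets [L]
    in at most one point.  If [L] contains a copy of the Cantor space and the
    copy of [Z], then [E] is Haar-1 and Haar-[I].  Disjointness
    also makes [((h, y), g) |-> g + t (h, y)] injective on the closed set of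
    triples with [g] in [h @` setT]; this map is Borel, so [E], the image of the
    uniformizing set, is in [Gam].

    The map [t] uses that [X] is not locally compact.  Some sequence [V] of
    neighbourhoods of [0] has the property that no [V n] is covered by finitely
    many translates of [V n.+1] ([unbounded_scale_exists]); this rests on the
    completeness of Polish Abelian groups for their group uniformity
    ([polish_group_complete]).  Consequently countably many compact sets can be
    moved apart by vectors of any prescribed smallness ([spread]).  At level [n]
    the pair [(h, y)] is coded by the first member of a dense sequence of maps
    that is close to [h], together with the bit [y n]; this code selects a vector
    from the spread family of level [n], and [t (h, y)] is the sum of the
    selected vectors ([separated_translates]).  The sum is a uniform limit of
    functions with countably many Borel pieces, hence Borel ([coded_borel]).

    All conditions on pointclasses concern Polish spaces, so products, closed
    subspaces, the Cantor space and spaces of continuous maps on a compact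
    space have to be shown to be Polish as well. *)

(** * Finite nets in compact sets *)

(** If no finite net existed, the sets of points missed by finite nets would
    generate a filter on [K]; it would have a cluster point [p], although one of
    its members, the set of points missed by the net [p], avoids [B p]. *)
Lemma compact_net (T : topologicalType) (K : set T) (B : T -> set T) :
  compact K -> (forall x, K x -> nbhs x (B x)) ->
  exists s : seq T, (forall y, y \in s -> K y) /\
    forall x, K x -> exists2 y, y \in s & B y x.
Proof.
move=> Kc nB; apply: contrapT => noS.
pose S (s : seq T) := [set x | K x /\ forall y, y \in s -> K y -> ~ B y x].
pose F : set_system T := filter_from [set: seq T] S.
have FF : ProperFilter F.
  apply: filter_from_proper; last first.
    move=> s _; apply: contrapT => s0; apply: noS.
    exists [seq y <- s | `[< K y >]]; split=> [y|x Kx].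
      by rewrite mem_filter => /andP[/asboolP].
    apply: contrapT => nx; apply: s0; exists x; split=> // y ys Ky Bx.
    by apply: nx; exists y => //; rewrite mem_filter ys andbT; apply/asboolP.
  apply: filter_from_filter; first by exists [::].
  move=> s t _ _; exists (s ++ t) => // x [Kx xs].
  by split; split=> // y ys; apply: xs; rewrite mem_cat ys ?orbT.
have FK : F K by exists [::] => // x [].
have [p [Kp clp]] := Kc F FF FK.
have [x [[_ xp] Bx]] : S [:: p] `&` B p !=set0.
  by apply: clp; [exists [:: p]|exact: nB].
by apply: (xp p _ Kp Bx); rewrite inE.
Qed.

(** * Metrics *)

Section Metric.
Variables (R : realType) (T : topologicalType) (d : T -> T -> R).
Hypothesis dM : metrizes d.

Lemma metrizes_xx x : d x x = 0. Proof. by case: dM => -[]. Qed.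

Lemma metrizes_eq0 x y : d x y = 0 -> x = y.
Proof. by case: dM => -[_ + _ _] _; apply. Qed.

Lemma metrizesC x y : d x y = d y x. Proof. by case: dM => -[]. Qed.

Lemma metrizes_triangle x y z : d x z <= d x y + d y z.
Proof. by case: dM => -[]. Qed.

Lemma metrizes_ge0 x y : 0 <= d x y.
Proof.
have := metrizes_triangle x y x.
by rewrite metrizes_xx (metrizesC y x) -mulr2n pmulrn_lge0.
Qed.

Lemma metrizes_nbhs x A :
  nbhs x A <-> exists2 e : R, 0 < e & forall y, d x y < e -> A y.
Proof. by case: dM => _; apply. Qed.

Lemma nbhs_dball x e : 0 < e -> nbhs x [set y | d x y < e].
Proof. by move=> e0; apply/metrizes_nbhs; exists e. Qed.

Lemma open_dball x e : open [set y | d x y < e].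
Proof.
rewrite openE => y /= xy; apply/metrizes_nbhs; exists (e - d x y).
  by rewrite subr_gt0.
move=> z yz; apply: le_lt_trans (metrizes_triangle x y z) _.
by rewrite addrC -ltrBrDr.
Qed.

Lemma metrizes_hausdorff : hausdorff_space T.
Proof.
move=> p q pq; apply: contrapT => npq.
have d0 : 0 < d p q / 2.
  rewrite divr_gt0// lt_neqAle metrizes_ge0 andbT eq_sym.
  by apply/eqP => /metrizes_eq0.
have [z [/= pz qz]] := pq _ _ (nbhs_dball p d0) (nbhs_dball q d0).
have := metrizes_triangle p z q; rewrite leNgt => /negP; apply.
by rewrite (metrizesC z q) [ltRHS]splitr ltrD.
Qed.

Lemma metrizes_cvgP (u : nat -> T) l :
  u @ \oo --> l <->
  forall e, 0 < e -> exists N, forall n, (N <= n)%N -> d l (u n) < e.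
Proof.
split=> [ul e e0|ul A /metrizes_nbhs[e e0 eA]].
  by have [N _ NP] := ul _ (nbhs_dball l e0); exists N => n /NP.
by have [N NP] := ul _ e0; exists N => // n /NP /eA.
Qed.

End Metric.

(** Separability in a form that passes without effort to subspaces, products and
    function spaces: at every scale, natural numbers suffice to locate points. *)
Definition resolvable (R : realType) (T : Type) (d : T -> T -> R) :=
  forall e : R, 0 < e ->
    exists c : T -> nat, forall x y, c x = c y -> d x y < e.

Lemma countable_sequence (T : Type) (x0 : T) (D : set T) :
  countable D -> exists u : nat -> T, forall x, D x -> exists n, u n = x.
Proof.
move=> /countable_injP[f fI].
pose w n x := D x /\ f x = n.
have [u uP] : {u : nat -> T & forall n, (exists x, w n x) -> w n (u n)}.
  apply: (@choice _ _ (fun n y => (exists x, w n x) -> w n y)) => n.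
  by have [[x wx]|nw] := pselect (exists x, w n x); [exists x|exists x0].
exists u => x Dx; exists (f x).
have [Du fu] : w (f x) (u (f x)) by apply: uP; exists x.
by apply: fI => //; rewrite inE.
Qed.

Lemma separable_resolvable (R : realType) (T : topologicalType)
    (d : T -> T -> R) : metrizes d ->
  (exists D : set T, countable D /\ dense D) <-> resolvable d.
Proof.
move=> dM; split=> [[D [Dc Dd]] e e0|dr].
  have [x0|noT] := pselect (exists _ : T, True); last first.
    by exists (fun=> 0%N) => x; case: noT; exists x.
  have [x00 _] := x0.
  have [u uD] := countable_sequence x00 Dc.
  have e20 : 0 < e / 2 by rewrite divr_gt0.
  have [c cP] : {c : T -> nat & forall x, d x (u (c x)) < e / 2}.
    apply: (@choice _ _ (fun x n => d x (u n) < e / 2)) => x.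
    have [|y [/= xy Dy]] := Dd [set y | d x y < e / 2] _ (open_dball dM x _).
      by exists x; rewrite /= (metrizes_xx dM).
    by have [n un] := uD _ Dy; exists n; rewrite un.
  exists c => x y cxy; apply: le_lt_trans (metrizes_triangle dM _ (u (c x)) _) _.
  rewrite [ltRHS]splitr ltrD// cxy (metrizesC dM) //.
have [[x0 _]|noT] := pselect (exists _ : T, True); last first.
  by exists set0; split=> [//|O [x _]]; case: noT; exists x.
have [c cP] : {c : nat -> T -> nat &
    forall n x y, c n x = c n y -> d x y < n.+1%:R^-1}.
  apply: (@choice _ _ (fun n c => forall x y, c x = c y -> d x y < n.+1%:R^-1)).
  by move=> n; apply: dr; rewrite invr_gt0.
have [r rP] : {r : nat * nat -> T & forall p,
    (exists x, c p.1 x = p.2) -> c p.1 (r p) = p.2}.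
  apply: (@choice _ _ (fun p y => (exists x, c p.1 x = p.2) -> c p.1 y = p.2)).
  move=> p; have [[x cx]|nw] := pselect (exists x, c p.1 x = p.2).
    by exists x.
  by exists x0.
(* one representative for each code that occurs, at each scale 1/(n+1) *)
exists (range r); split.
  exact: sub_countable (card_image_le _ _) (countableP _).
move=> O [x Ox] oO.
have /(metrizes_nbhs dM)[e e0 eO] : nbhs x O by exact: open_nbhs_nbhs.
have [n] := ltr_add_invr e0; rewrite add0r => ne.
exists (r (n, c n x)); split; last by exists (n, c n x).
apply: eO; apply: lt_trans ne; apply: cP.
by rewrite (rP (n, c n x)) //; exists x.
Qed.

Definition polish_metric (R : realType) (T : topologicalType)
    (d : T -> T -> R) :=
  [/\ metrizes d, metric_complete d & resolvable d].

Lemma polishP (R : realType) (T : topologicalType) :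
  polish R T <-> exists d : T -> T -> R, polish_metric d.
Proof.
split=> [[sT [d [dM dc]]]|[d [dM dc dr]]].
  by exists d; split=> //; apply/separable_resolvable.
by split; [apply/(separable_resolvable dM)|exists d].
Qed.

Lemma polish_hausdorff (R : realType) (T : topologicalType) :
  polish R T -> hausdorff_space T.
Proof. by case=> _ [d [/metrizes_hausdorff]]. Qed.

(** * Polish spaces *)

Lemma polish_prod (R : realType) (S T : topologicalType) :
  polish R S -> polish R T -> polish R (S * T)%type.
Proof.
move=> /polishP[d [dM dc dr]] /polishP[g [gM gc gr]]; apply/polishP.
exists (fun x y => d x.1 y.1 + g x.2 y.2).
have d0 := metrizes_ge0 dM; have g0 := metrizes_ge0 gM.
split.
- split; first split.
  + by move=> x; rewrite (metrizes_xx dM) (metrizes_xx gM) addr0.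
  + move=> [x x'] [y y'] /= /eqP; rewrite paddr_eq0// => /andP[/eqP + /eqP].
    by move=> /(metrizes_eq0 dM) -> /(metrizes_eq0 gM) ->.
  + by move=> x y; rewrite (metrizesC dM) (metrizesC gM).
  + move=> x y z; rewrite addrACA lerD//.
      exact: metrizes_triangle dM _ _ _.
    exact: metrizes_triangle gM _ _ _.
  + move=> [x y] A; split.
      move=> [[A1 A2] [/= /(metrizes_nbhs dM)[e e0 eA]]].
      move=> /(metrizes_nbhs gM)[f f0 fA] A12.
      exists (Num.min e f); first by rewrite lt_min e0.
      move=> [x' y'] /=; rewrite lt_min => /andP[xe yf]; apply: A12; split=> /=.
        by apply: eA; apply: le_lt_trans xe; rewrite lerDl.
      by apply: fA; apply: le_lt_trans yf; rewrite lerDr.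
    move=> [e e0 eA]; have e20 : 0 < e / 2 by rewrite divr_gt0.
    exists ([set x' | d x x' < e / 2], [set y' | g y y' < e / 2]).
      by split; [exact: (nbhs_dball dM)|exact: (nbhs_dball gM)].
    by move=> [x' y'] [/= xx yy]; apply: eA; rewrite /= [ltRHS]splitr ltrD.
- move=> u uC.
  have [l ul] : exists l : S, (fst \o u) @ \oo --> l.
    apply: dc => e /uC[N NP]; exists N => m n Nm Nn.
    by apply: le_lt_trans (NP _ _ Nm Nn); rewrite lerDl.
  have [k uk] : exists l : T, (snd \o u) @ \oo --> l.
    apply: gc => e /uC[N NP]; exists N => m n Nm Nn.
    by apply: le_lt_trans (NP _ _ Nm Nn); rewrite lerDr.
  exists (l, k).
  have -> : u = (fun n => ((fst \o u) n, (snd \o u) n)).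
    by apply/funext => n /=; case: (u n).
  exact: cvg_pair ul uk.
- move=> e e0; have e20 : 0 < e / 2 by rewrite divr_gt0.
  have [c cP] := dr _ e20; have [c' c'P] := gr _ e20.
  exists (fun x => pickle (c x.1, c' x.2)) => x y.
  move=> /(pcan_inj (@pickleK _)) [/cP xy /c'P xy'].
  by rewrite [ltRHS]splitr ltrD.
Qed.

Lemma polish_compact (R : realType) (T : topologicalType) :
  compact [set: T] -> metrizable R T -> polish R T.
Proof.
move=> Tc [d dM]; apply/polishP; exists d; split=> //.
- move=> u uC.
  have [l [_ cl]] := Tc (u @ \oo) _ filterT.
  exists l; apply/(metrizes_cvgP dM) => e e0.
  have e20 : 0 < e / 2 by rewrite divr_gt0.
  have [N NP] := uC _ e20; exists N => n Nn.
  have [|y [[m/= Nm <-] ly]] := cl (u @` [set m | (N <= m)%N])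
      [set y | d l y < e / 2] _ (nbhs_dball dM l e20).
    by exists N => // m Nm; exists m.
  apply: le_lt_trans (metrizes_triangle dM _ (u m) _) _.
  by rewrite [ltRHS]splitr ltrD// NP.
- move=> e e0; have e20 : 0 < e / 2 by rewrite divr_gt0.
  have [s [_ sP]] := compact_net Tc (fun x _ => nbhs_dball dM x e20).
  exists (fun x => find (fun y => d y x < e / 2) s) => x y cxy.
  have sF z : d (nth x s (find (fun y => d y z < e / 2) s)) z < e / 2.
    apply: (@nth_find _ x (fun y => d y z < e / 2)).
    by have [y' ys yz] := sP z I; apply/hasP; exists y'.
  have := sF y; rewrite -[find _ _]cxy => sy.
  apply: le_lt_trans (metrizes_triangle dM _ _ _) _; last first.
    rewrite [ltRHS]splitr; apply: ltrD; last exact: sy.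
    by rewrite (metrizesC dM).
Qed.

Lemma polish_closed (R : realType) (T : topologicalType) (A : set T) :
  polish R T -> closed A -> polish R A.
Proof.
move=> /polishP[d [dM dc dr]] cA; apply/polishP.
exists (fun x y : A => d (val x) (val y)); split.
- split; first split.
  + by move=> x; rewrite (metrizes_xx dM).
  + by move=> x y /(metrizes_eq0 dM) /val_inj.
  + by move=> x y; rewrite (metrizesC dM).
  + by move=> x y z; exact: metrizes_triangle dM _ _ _.
  + move=> x B; split.
      move=> [_ /= [[ O oO <-] Ox] OB].
      have /(metrizes_nbhs dM)[e e0 eO] : nbhs (set_val x) O.
        exact: open_nbhs_nbhs.
      by exists e => // y /eO; exact: OB.
    move=> [e e0 eB]; exists (set_val @^-1` [set y | d (val x) y < e]) => //.
    split; first by exists [set y | d (val x) y < e] => //; exact: (open_dball dM _ _).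
      by rewrite /= set_valE (metrizes_xx dM).
    by move=> y; rewrite /= set_valE => /eB.
- move=> u uC; have [l ul] := dc (fun n => val (u n)) uC.
  have Al : A l.
    by apply: (closed_cvg _ cA _ _ ul); apply: nearW => n; exact: set_valP.
  exists (exist _ l (mem_set Al)) => B.
  move=> [_ /= [[ O oO <-] Ol] OB].
  have [N _ NP] := ul O (open_nbhs_nbhs (conj oO Ol)).
  by exists N => // n /NP; rewrite /= -set_valE => /OB.
- move=> e /dr[c cP]; exists (c \o val) => x y /cP //.
Qed.

(** * The Cantor space *)

Lemma cantor_nbhs (x : cantor_space) (A : set cantor_space) :
  nbhs x A <->
  exists n, forall y : cantor_space, (forall i, (i < n)%N -> y i = x i) -> A y.
Proof.
split=> [|[n nA]]; last first.
  suff cyl : nbhs x [set y | forall i, (i < n)%N -> y i = x i].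
    by apply: filterS cyl.
  elim: n {nA} => [|n IH]; first by apply: filterS filterT => y _ i; rewrite ltn0.
  have xn : nbhs (x n) [set x n] by exact: discrete_set1.
  have := @proj_continuous nat (fun=> bool : topologicalType) n x _ xn.
  apply: filterS2 IH => y yx yn i; rewrite ltnS leq_eqVlt => /orP[/eqP ->|] //.
  exact: yx.
pose F : set_system cantor_space := filter_from [set: nat]
  (fun n => [set y | forall i, (i < n)%N -> y i = x i]).
have FF : Filter F.
  apply: filter_from_filter; first by exists 0%N.
  move=> m n _ _; exists (maxn m n) => // y yx.
  by split=> i im; apply: yx; rewrite leq_max im ?orbT.
have Fx : F --> x.
  apply/cvg_sup => i; move=> B [_ /= [[W oW <-] /= Wx] WB].
  by exists i.+1 => // y yx; apply: WB; rewrite /= yx.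
by move=> /Fx[n _ nA]; exists n.
Qed.

Lemma cantor_metrizable (R : realType) : metrizable R cantor_space.
Proof.
pose diff (x y : cantor_space) := [pred n | x n != y n].
have diffP x y : x <> y -> exists n, diff x y n.
  move=> nxy; apply: contrapT => nd; apply: nxy; apply/funext => n.
  by apply/eqP; apply: contrapT => /negP xyn; apply: nd; exists n.
pose d (x y : cantor_space) : R :=
  if pselect (exists n, diff x y n) is left xy then (ex_minn xy).+1%:R^-1 else 0.
have dP x y n : d x y < n.+1%:R^-1 <-> forall i, (i <= n)%N -> x i = y i.
  rewrite /d; case: pselect => [xy|xy]; last first.
    split=> [_ i _|_]; last by rewrite invr_gt0.
    by apply/eqP; apply: contrapT => /negP xyi; apply: xy; exists i.
  case: ex_minnP => m xym mmin; rewrite ltf_pV2 ?posrE// ltr_nat ltnS.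
  split=> [nm i ilen|agr].
    apply/eqP; apply: contraTT nm => /mmin mi.
    by rewrite -leqNgt (leq_trans mi).
  by rewrite ltnNge; apply/negP => /agr xym'; move: xym; rewrite /= xym' eqxx.
have d0 x y : 0 <= d x y by rewrite /d; case: pselect => // ?; rewrite invr_ge0.
have dle x y r : 0 <= r -> (forall n, r < n.+1%:R^-1 -> d x y < n.+1%:R^-1) ->
    d x y <= r.
  move=> r0 H; rewrite /d; case: pselect => // xy; case: ex_minnP => m xym _.
  rewrite leNgt; apply/negP => /H/dP/(_ m (leqnn m)) xym'.
  by move: xym; rewrite /= xym' eqxx.
exists d; split; first split.
- move=> x; apply/eqP; rewrite eq_le d0 andbT; apply: dle => // n _.
  by apply/dP.
- move=> x y xy0; apply/funext => n.
  by have /dP/(_ n (leqnn n)) : d x y < n.+1%:R^-1 by rewrite xy0 invr_gt0.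
- have sym x y : d x y <= d y x.
    by apply: dle => // n /dP yx; apply/dP => i /yx.
  by move=> x y; apply/eqP; rewrite eq_le !sym.
- move=> x y z; apply: dle => [|n xyz]; first by rewrite addr_ge0.
  have /dP xy : d x y < n.+1%:R^-1 by apply: le_lt_trans xyz; rewrite lerDl.
  have /dP yz : d y z < n.+1%:R^-1 by apply: le_lt_trans xyz; rewrite lerDr.
  by apply/dP => i ilen; rewrite xy// yz.
- move=> x A; split.
    move=> /cantor_nbhs[n nA]; exists n.+1%:R^-1; first by rewrite invr_gt0.
    by move=> y /= /dP xy; apply: nA => i ilt; rewrite xy// ltnW.
  move=> [e e0 eA]; have [n] := ltr_add_invr e0; rewrite add0r => ne.
  apply/cantor_nbhs; exists n.+1 => y yx; apply: eA => /=.
  by apply: lt_trans ne; apply/dP => i ilen; rewrite yx.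
Qed.

Lemma cantor_polish (R : realType) : polish R cantor_space.
Proof. exact: polish_compact cantor_space_compact (cantor_metrizable R). Qed.

(** * Spaces of continuous maps on a compact space *)

(** The form in which compactness of the domain is used for function spaces:
    conditions required uniformly over the domain define open sets of maps. *)
Lemma tube_open (Z S : topologicalType) (P : set (Z * S)) :
  compact [set: Z] -> open P -> open [set s | forall z, P (z, s)].
Proof.
move=> /compact_near_coveringP Zc oP; rewrite openE => s sP.
have H := Zc S (nbhs s) (fun s z => P (z, s)) _.
have : \forall s' \near s, [set: Z] `<=` (fun z => P (z, s')).
  apply: H => z _; have [AB nAB ABP] := open_nbhs_nbhs (conj oP (sP z)).
  by exists AB => // -[z' s'] /ABP.
by apply: filterS => s' sP' z; exact: sP'.
Qed.

Section UniformMetric.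
Variable R : realType.

(** One statement serves both for Lebesgue numbers ([f] the identity and [O]
    constant) and for uniform continuity ([O x] a ball centred at [f x]). *)
Lemma lebesgue_number (S T : topologicalType) (d : S -> S -> R)
    (K : set S) (f : S -> T) (O : S -> set T) :
  metrizes d -> compact K ->
  (forall x, K x -> exists2 e : R, 0 < e &
     forall x' y, d x x' < e -> d x' y < e -> O x' (f y)) ->
  exists2 e : R, 0 < e & forall x y, K x -> d x y < e -> O x (f y).
Proof.
move=> dM /compact_near_coveringP Kc KO.
have := Kc nat \oo (fun n x => forall y, d x y < n.+1%:R^-1 -> O x (f y)) _.
case=> [x Kx|N _ NP]; last first.
  exists N.+1%:R^-1; first by rewrite invr_gt0.
  by move=> x y Kx xy; apply: (NP N) => /=.
have [e e0 eO] := KO x Kx; have [m] := ltr_add_invr e0; rewrite add0r => me.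
exists ([set x' | d x x' < e], [set n | (m <= n)%N]).
  by split; [exact: nbhs_dball|exists m].
move=> [x' n] [/= xx' mn] y x'y; apply: (eO x') => //.
apply: lt_trans me; apply: lt_le_trans x'y _.
by rewrite lef_pV2 ?posrE// ler_nat ltnS.
Qed.

Import ArrowAsCompactOpen.
Variables (Z X : topologicalType) (d : X -> X -> R).
Hypotheses (Zc : compact [set: Z]) (dM : metrizes d).
Local Notation C := (continuousType Z X).

Let nbhs_preimage_dball (h : C) z e :
  0 < e -> nbhs z [set z' | d (h z) (h z') < e].
Proof. by move=> e0; exact: (@cts_fun _ _ h z _ (nbhs_dball dM (h z) e0)). Qed.

(** On a compact domain the compact-open topology is that of uniform
    convergence.  A uniform ball around [h] contains a finite intersection of
    subbasic sets: one for each piece of a finite cover of [Z] on which [h]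
    varies little. *)
Lemma nbhs_continuousTypeP (h : C) (A : set C) :
  nbhs h A <->
  exists2 e, 0 < e & forall h' : C, (forall z, d (h z) (h' z) < e) -> A h'.
Proof.
split.
  pose F : set_system {compact-open, Z -> X} :=
    filter_from [set e : R | 0 < e]
      (fun e => [set f | forall z, d (h z) (f z) < e]).
  have FF : Filter F.
    apply: filter_from_filter; first by exists 1 => /=.
    move=> e e' /= e0 e'0; exists (Num.min e e'); first by rewrite /= lt_min e0.
    by move=> f fe; split=> z; have := fe z; rewrite lt_min => /andP[].
  have Fh : F --> (h : {compact-open, Z -> X}).
    apply/compact_open_cvgP => K O Kc oO hKO.
    have hKc : compact (h @` K).
      apply: continuous_compact => //; apply: continuous_subspaceT.
      exact: cts_fun.
    have [|e e0 eO] := @lebesgue_number _ _ d (h @` K) id (fun=> O) dM hKc.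
      move=> x /hKO Ox.
      have /(metrizes_nbhs dM)[e e0 eO] : nbhs x O by exact: open_nbhs_nbhs.
      exists (e / 2); first by rewrite divr_gt0.
      move=> x' y xx' x'y; apply: eO; rewrite [ltRHS]splitr.
      by apply: le_lt_trans (metrizes_triangle dM _ x' _) _; rewrite ltrD.
    by exists e => // f fe _ [z Kz <-]; apply: (eO (h z)) (fe z); exists z.
  move=> [_ /= [[W oW <-] Wh] WA].
  have [e e0 eW] := Fh W (open_nbhs_nbhs (conj oW Wh)).
  by exists e => // h' hh'; apply: WA; exact: eW.
move=> [e e0 eA].
have e40 : 0 < e / 4 by rewrite divr_gt0.
have e4 : e / 4 + e / 4 + (e / 4 + e / 4) = e.
  by lra.
have [s [_ sP]] := @compact_net _ _ (fun z => [set z' | d (h z) (h z') < e / 4])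
  Zc (fun z _ => nbhs_preimage_dball h z e40).
pose K z := [set z' | d (h z) (h z') <= e / 4].
pose O z := [set x | d (h z) x < e / 4 + e / 4].
have KO z : nbhs h [set h' : C | h' @` K z `<=` O z].
  have oW : open ([set f | f @` K z `<=` O z] : set {compact-open, Z -> X}).
    apply: compact_open_open; last exact: open_dball.
    apply: subclosed_compact Zc _ => //.
    rewrite -openC (_ : ~` _ = h @^-1` (~` [set x | d (h z) x <= e / 4])) //.
    apply: open_comp => [z' _|]; first exact: cts_fun.
    rewrite openE => x /= /negP; rewrite -ltNge => zx.
    apply/(metrizes_nbhs dM); exists (d (h z) x - e / 4); first by rewrite subr_gt0.
    move=> y xy /=; apply/negP; rewrite -ltNge.
    have := metrizes_triangle dM (h z) y x.
    rewrite (metrizesC dM y x) -lerBlDr; apply: lt_le_trans.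
    by rewrite ltrBrDl -ltrBrDr.
  have hW : h @` K z `<=` O z.
    move=> _ [z' zz' <-]; rewrite /O /=; apply: le_lt_trans zz' _.
    by rewrite ltrDl.
  exact: (@initial_continuous C (Z -> X) id h _ (open_nbhs_nbhs (conj oW hW))).
have : nbhs h [set h' : C | forall y, y \in s -> h' @` K y `<=` O y].
  elim: s {sP} => [|y s IH]; first by apply: filterS filterT => h' _ y; rewrite in_nil.
  apply: filterS2 (KO y) IH => h' h'y IH' y'; rewrite inE => /orP[/eqP -> //|].
  exact: IH'.
apply: filterS => h' h's; apply: eA => z.
have [y ys /= yz] := sP z I.
have yz' : O y (h' z) by apply: (h's y ys); exists z => //; exact: ltW.
apply: le_lt_trans (metrizes_triangle dM _ (h y) _) _.
rewrite (metrizesC dM) -[ltRHS]e4; apply: ltrD => //.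
by apply: lt_trans yz _; rewrite ltrDl.
Qed.

Lemma eval_compact_continuous : continuous (fun p : Z * C => p.2 p.1).
Proof.
move=> [z h] A /= /(metrizes_nbhs dM)[e e0 eA].
have e20 : 0 < e / 2 by rewrite divr_gt0.
exists ([set z' | d (h z) (h z') < e / 2],
        [set h' : C | forall z, d (h z) (h' z) < e / 2]).
  split; last by apply/nbhs_continuousTypeP; exists (e / 2).
  exact: nbhs_preimage_dball.
move=> [z' h'] [/= zz' hh']; apply: eA; rewrite [ltRHS]splitr.
by apply: le_lt_trans (metrizes_triangle dM _ (h z') _) _; rewrite ltrD.
Qed.

Hypothesis Z0 : [set: Z] !=set0.

Definition sup_dist (f g : C) : R := sup (range (fun z => d (f z) (g z))).

Lemma sup_dist_le (f g : C) e : (forall z, d (f z) (g z) <= e) -> sup_dist f g <= e.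
Proof.
move=> fg; apply: ge_sup; last by move=> _ [z _ <-].
by have [z _] := Z0; exists (d (f z) (g z)), z.
Qed.

Lemma le_sup_dist (f g : C) z : d (f z) (g z) <= sup_dist f g.
Proof.
apply: ub_le_sup; last by exists z.
have [s [_ sP]] := @compact_net _ _ (fun z => [set z' | d (f z) (f z') < 1] `&`
    [set z' | d (g z) (g z') < 1]) Zc (fun z _ => filterI
  (nbhs_preimage_dball f z ltr01) (nbhs_preimage_dball g z ltr01)).
exists (1 + (\sum_(y <- s) d (f y) (g y) + 1)) => _ [x _ <-].
have [y ys [/= fyx gyx]] := sP x I.
apply: le_trans (metrizes_triangle dM _ (f y) _) _.
apply: lerD; first by rewrite (metrizesC dM) ltW.
apply: le_trans (metrizes_triangle dM _ (g y) _) _.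
apply: lerD; last exact: ltW.
rewrite (big_rem y)//= lerDl; apply: sumr_ge0 => i _; exact: metrizes_ge0 dM _ _.
Qed.

Lemma sup_dist_metrizes : metrizes sup_dist.
Proof.
split; first split.
- move=> f; apply/eqP; rewrite eq_le; apply/andP; split.
    by apply: sup_dist_le => z; rewrite (metrizes_xx dM).
  by have [z _] := Z0; rewrite -(metrizes_xx dM (f z)) le_sup_dist.
- move=> f g fg; apply/continuousEP => z; apply: (metrizes_eq0 dM).
  by apply/eqP; rewrite eq_le (metrizes_ge0 dM) andbT -fg le_sup_dist.
- by move=> f g; congr sup; apply: eq_imagel => z _; rewrite (metrizesC dM).
- move=> f g h; apply: sup_dist_le => z.
  apply: le_trans (metrizes_triangle dM _ (g z) _) _.
  by rewrite lerD// le_sup_dist.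
- move=> h A; split=> [/nbhs_continuousTypeP[e e0 eA]|[e e0 eA]].
    exists e => // h' /= hh'; apply: eA => z.
    exact: le_lt_trans (le_sup_dist _ _ _) hh'.
  apply/nbhs_continuousTypeP; exists (e / 2); first by rewrite divr_gt0.
  move=> h' hh'; apply: eA => /=; apply: (@le_lt_trans _ _ (e / 2)).
    by apply: sup_dist_le => z; rewrite ltW.
  by rewrite ltr_pdivrMr// ltr_pMr// ltr1n.
Qed.

Lemma sup_dist_complete : metric_complete d -> metric_complete sup_dist.
Proof.
move=> dc u uC.
have [l ul] : {l : Z -> X & forall z, (fun n => u n z) @ \oo --> l z}.
  apply: (@choice _ _ (fun z x => (fun n => u n z) @ \oo --> x)) => z.
  apply: dc => e /uC[N NP]; exists N => m n Nm Nn.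
  exact: le_lt_trans (le_sup_dist _ _ _) (NP _ _ Nm Nn).
have unif e : 0 < e -> exists N, forall n, (N <= n)%N ->
    forall z, d (l z) (u n z) < e.
  move=> e0; have e20 : 0 < e / 2 by rewrite divr_gt0.
  have [N NP] := uC _ e20; exists N => n Nn z.
  have /(metrizes_cvgP dM)/(_ _ e20)[M MP] := ul z.
  apply: le_lt_trans (metrizes_triangle dM _ (u (maxn M N) z) _) _.
  rewrite [ltRHS]splitr; apply: ltrD; first by rewrite MP// leq_maxl.
  by apply: le_lt_trans (le_sup_dist _ _ _) (NP _ _ _ Nn); rewrite leq_maxr.
have lc : continuous l.
  move=> z A /= /(metrizes_nbhs dM)[e e0 eA].
  have e40 : 0 < e / 2 / 2 by rewrite !divr_gt0.
  have [N NP] := unif _ e40; have := nbhs_preimage_dball (u N) z e40.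
  apply: filterS => z' /= zz'; apply: eA.
  apply: le_lt_trans (metrizes_triangle dM _ (u N z) _) _.
  rewrite [ltRHS]splitr; apply: ltrD.
    apply: lt_trans (NP _ (leqnn _) z) _.
    by rewrite ltr_pdivrMr// ltr_pMr// ?divr_gt0// ltr1n.
  apply: le_lt_trans (metrizes_triangle dM _ (u N z') _) _.
  by rewrite [ltRHS]splitr; apply: ltrD => //; rewrite (metrizesC dM) NP.
pose L : C := mkcts lc.
exists L; apply/(metrizes_cvgP sup_dist_metrizes) => e e0.
have e20 : 0 < e / 2 by rewrite divr_gt0.
have [N NP] := unif _ e20; exists N => n Nn; apply: (@le_lt_trans _ _ (e / 2)).
  by apply: sup_dist_le => z; rewrite ltW// NP.
by rewrite ltr_pdivrMr// ltr_pMr// ltr1n.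
Qed.

(** A map is located up to [e] by a modulus [m] of uniform continuity together
    with codes for its values on a finite net of mesh [1/(m+1)]. *)
Lemma sup_dist_resolvable : metrizable R Z -> resolvable d -> resolvable sup_dist.
Proof.
move=> [g gM] dr e e0; have e40 : 0 < e / 2 / 2 by rewrite !divr_gt0.
have [c cP] := dr _ e40.
have [s sP] : {s : nat -> seq Z & forall n z, exists2 y, y \in s n &
    g y z < n.+1%:R^-1}.
  apply: (@choice _ _ (fun n s => forall z, exists2 y, y \in s &
    g y z < n.+1%:R^-1)) => n.
  have n0 : 0 < n.+1%:R^-1 :> R by rewrite invr_gt0.
  have [s [_ sP]] := compact_net Zc (fun z _ => nbhs_dball gM z n0).
  by exists s => z; exact: sP.
have [m mP] : {m : C -> nat & forall (h : C) z z',
    g z z' < (m h).+1%:R^-1 -> d (h z) (h z') < e / 2 / 2 / 2}.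
  apply: (@choice _ _ (fun (h : C) m => forall z z',
    g z z' < m.+1%:R^-1 -> d (h z) (h z') < e / 2 / 2 / 2)) => h.
  have e80 : 0 < e / 2 / 2 / 2 / 2 by rewrite !divr_gt0.
  have [|r r0 rP] := @lebesgue_number Z X g setT h
      (fun x => [set y | d (h x) y < e / 2 / 2 / 2]) gM Zc.
    move=> z _.
    have /(metrizes_nbhs gM)[r r0 rP] :=
      nbhs_preimage_dball h z e80.
    exists (r / 2); first by rewrite divr_gt0.
    move=> z' y zz' z'y /=.
    apply: le_lt_trans (metrizes_triangle dM _ (h z) _) _.
    rewrite [ltRHS]splitr; apply: ltrD; first rewrite (metrizesC dM).
      apply: rP; apply: lt_trans zz' _.
      by rewrite ltr_pdivrMr// ltr_pMr// ltr1n.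
    apply: rP; apply: le_lt_trans (metrizes_triangle gM _ z' _) _.
    by rewrite [ltRHS]splitr ltrD.
  have [m] := ltr_add_invr r0; rewrite add0r => mr.
  by exists m => z z' zz'; apply: rP => //; exact: lt_trans mr.
exists (fun h => pickle (m h, map (c \o h) (s (m h)))) => f h.
move=> /(pcan_inj (@pickleK _))[mm]; rewrite -mm => /eq_in_map ss.
have e2lt : e / 2 < e by rewrite ltr_pdivrMr// ltr_pMr// ltr1n.
apply: le_lt_trans e2lt; apply: sup_dist_le => z; apply: ltW.
have [y ys yz] := sP (m f) z.
apply: le_lt_trans (metrizes_triangle dM _ (f y) _) _.
apply: le_lt_trans (lerD (lexx _) (metrizes_triangle dM _ (h y) _)) _.
rewrite addrCA [ltRHS]splitr; apply: ltrD; first by apply/cP/ss.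
rewrite [ltRHS]splitr; apply: ltrD.
  by rewrite (metrizesC dM); exact: mP.
by apply: mP; rewrite -mm.
Qed.

End UniformMetric.

Section PolishContinuous.
Import ArrowAsCompactOpen.

Lemma polish_continuousType (R : realType) (Z X : topologicalType) :
  [set: Z] !=set0 -> compact [set: Z] -> metrizable R Z -> polish R X ->
  polish R (continuousType Z X).
Proof.
move=> Z0 Zc Zm /polishP[d [dM dc dr]]; apply/polishP.
exists (@sup_dist R Z X d); split.
- exact: sup_dist_metrizes.
- exact: sup_dist_complete.
- exact: sup_dist_resolvable.
Qed.

End PolishContinuous.

(** * Borel sets and Borel maps *)

Section Borel.
Variable T : topologicalType.
Local Notation borel := <<s @open T >>.

Lemma borel_open (A : set T) : open A -> borel A.
Proof. exact: sub_sigma_algebra. Qed.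

Lemma borelC (A : set T) : borel A -> borel (~` A).
Proof.
have [_ + _] := smallest_sigma_algebra [set: T] (@open T).
by move=> bC /bC; rewrite setTD.
Qed.

Lemma borel_bigcup (I : countType) (F : I -> set T) :
  (forall i, borel (F i)) -> borel (\bigcup_i F i).
Proof.
move=> FB; have [b0 _ bU] := smallest_sigma_algebra [set: T] (@open T).
rewrite (_ : \bigcup_i F i = \bigcup_n (oapp F set0 (@unpickle I n))).
  by apply: bU => n; case: (unpickle n) => [i|] //=; exact: FB.
apply/seteqP; split=> [x [i _ Fx]|x [n _]].
  by exists (pickle i) => //; rewrite pickleK.
by case: (unpickle n) => [i /= Fx|//]; exists i.
Qed.

Lemma borelI (A B : set T) : borel A -> borel B -> borel (A `&` B).
Proof.
move=> bA bB; rewrite -[A `&` B]setCK setCI; apply: borelC.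
rewrite (_ : _ `|` _ = \bigcup_(b : bool) (if b then ~` A else ~` B)).
  by apply: borel_bigcup => -[]; exact: borelC.
apply/seteqP; split=> [x [Ax|Bx]|x [[] _ ?]].
- by exists true.
- by exists false.
- by left.
- by right.
Qed.

End Borel.

Lemma borel_map_open (S T : topologicalType) (f : S -> T) :
  (forall U, open U -> <<s @open S >> (f @^-1` U)) -> borel_map f.
Proof.
move=> fU B; apply: (smallest_sub
  (X := [set B : set T | <<s @open S >> (f @^-1` B)]) _ fU).
split=> [|A fA|A fA]; rewrite /= ?preimage_set0.
- by have [] := smallest_sigma_algebra [set: S] (@open S).
- by rewrite setTD preimage_setC; exact: borelC.
- by rewrite preimage_bigcup; exact: borel_bigcup.
Qed.

Lemma continuous_borel_map (S T : topologicalType) (f : S -> T) :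
  continuous f -> borel_map f.
Proof.
move=> fc; apply: borel_map_open => U oU; apply: borel_open.
by apply: open_comp => // x _; exact: fc.
Qed.

(** * Topological Abelian groups *)

Section Group.
Variable X : topologicalZmodType.
Implicit Types (U V W : set X) (x y : X).

Lemma nbhs0_add U : nbhs (0 : X) U ->
  exists2 V, nbhs (0 : X) V & forall x y, V x -> V y -> U (x + y).
Proof.
move=> U0; have := @add_continuous X (0, 0) U; rewrite /= addr0 => /(_ U0).
move=> [[A B] [/= nA nB] AB]; exists (A `&` B); first exact: filterI.
by move=> x y [Ax _] [_ By]; exact: (AB (x, y)).
Qed.

Lemma shift_continuous x : continuous (fun y : X => x + y).
Proof.
move=> y; apply: (@continuous_comp _ _ _ (fun y => (x, y)) (fun p : X * X => p.1 + p.2)).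
  by apply: cvg_pair; [exact: cvg_cst|exact: cvg_id].
exact: add_continuous.
Qed.

Lemma nbhs_shift x U : nbhs (0 : X) U -> nbhs x [set y | U (y - x)].
Proof.
move=> U0; have := @shift_continuous (- x) x; rewrite /continuous_at addNr.
suff -> : [set y | U (y - x)] = +%R (- x) @^-1` U by apply.
by apply/funext => y; rewrite /= addrC.
Qed.

Lemma nbhs_unshift x U : nbhs x U -> nbhs (0 : X) [set y | U (x + y)].
Proof. by move=> xU; have := @shift_continuous x 0; rewrite /continuous_at addr0; apply. Qed.

(** Such a sequence does the work of a translation-invariant metric. *)
Record scale (V : nat -> set X) : Prop := Scale {
  scale_open : forall n, open (V n);
  scale0 : forall n, V n 0;
  scaleN : forall n x, V n x -> V n (- x);
  scaleD : forall n x y, V n.+1 x -> V n.+1 y -> V n (x + y);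
  scale_base : forall U, nbhs (0 : X) U -> exists n, V n `<=` U
}.

Section Scale.
Variables (V : nat -> set X).
Hypothesis sV : scale V.

Lemma scale_nbhs n : nbhs (0 : X) (V n).
Proof. by apply: open_nbhs_nbhs; split; [exact: scale_open|exact: scale0]. Qed.

Lemma scale_le m n : (m <= n)%N -> V n `<=` V m.
Proof.
move=> /subnK <-; elim: (n - m)%N => [//|k IH] x Vx; apply: IH.
by rewrite -[x]addr0; apply: (scaleD sV) => //; exact: scale0.
Qed.

Lemma scaleB n x y : V n.+1 x -> V n.+1 y -> V n (x - y).
Proof. by move=> Vx Vy; apply: (scaleD sV) => //; exact: scaleN. Qed.

Lemma scale_cvg (u : nat -> X) l :
  u @ \oo --> l <->
  forall n, exists N, forall m, (N <= m)%N -> V n (u m - l).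
Proof.
split=> [ul n|ul A /nbhs_unshift/(scale_base sV)[n nA]].
  by have [N _ NP] := ul _ (nbhs_shift l (scale_nbhs n)); exists N => m /NP.
have [N NP] := ul n; exists N => // m /NP /nA /=.
by rewrite addrC subrK.
Qed.

End Scale.
End Group.

Section PolishGroup.
Variables (R : realType) (X : topologicalZmodType) (d : X -> X -> R).
Hypothesis dM : metrizes d.
Implicit Types (U V W : set X) (x y : X).

(** The parameter [Q] lets one impose a further relation between consecutive
    members, provided that it holds as soon as the second one is small enough. *)
Lemma scale_exists (Q : set X -> set X -> Prop) :
  (forall W, nbhs (0 : X) W ->
     exists2 N, nbhs (0 : X) N & forall U, U `<=` N -> Q W U) ->
  exists V : nat -> set X, scale V /\ forall n, Q (V n) (V n.+1).
Proof.
move=> QN.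
pose good (n : nat) W U := [/\ open U, U 0, (forall x, U x -> U (- x)) &
  [/\ forall x y, U x -> U y -> W (x + y),
      U `<=` [set x | d 0 x < n.+1%:R^-1] & Q W U]].
have [g gP] : {g : nat * set X -> set X &
    forall p, nbhs (0 : X) p.2 -> good p.1 p.2 (g p)}.
  apply: (@choice _ _ (fun p U => nbhs (0 : X) p.2 -> good p.1 p.2 U)).
  move=> [n W] /=; have [W0|nW] := pselect (nbhs (0 : X) W); last by exists W.
  have [N1 nN1 N1W] := nbhs0_add W0; have [N2 nN2 N2Q] := QN _ W0.
  have n0 : 0 < n.+1%:R^-1 :> R by rewrite invr_gt0.
  pose M := (N1 `&` N2 `&` [set x | d 0 x < n.+1%:R^-1])°.
  have M0 : M 0.
    apply: nbhs_singleton; apply: nbhs_interior.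
    by apply: filterI; [exact: filterI|exact: nbhs_dball].
  have MN : M `<=` N1 `&` N2 `&` [set x | d 0 x < n.+1%:R^-1].
    exact: interior_subset.
  exists (M `&` [set x | M (- x)]) => _; split.
  - apply: openI; first exact: open_interior.
    apply: open_comp; last exact: open_interior.
    by move=> x _; exact: opp_continuous.
  - by split => //=; rewrite oppr0.
  - by move=> x [Mx Mnx]; split => //=; rewrite opprK.
  split.
  - by move=> x y [/MN[[? _] _] _] [/MN[[? _] _] _]; exact: N1W.
  - by move=> x [/MN[]].
  - by apply: N2Q => x [/MN[[]]].
pose V := fix V n := if n is m.+1 then g (n, V m) else g (0%N, [set: X]).
have Vnb n : nbhs (0 : X) (V n).
  elim: n => [|n IH].
    have [oU U0 _ _] := gP (0%N, [set: X]) filterT.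
    by apply: open_nbhs_nbhs.
  by have [oU U0 _ _] := gP (n.+1, V n) IH; apply: open_nbhs_nbhs.
have Vg n : exists W, good n W (V n).
  case: n => [|n]; first by exists [set: X]; exact: (gP (0%N, [set: X]) filterT).
  by exists (V n); exact: (gP (n.+1, V n) (Vnb n)).
have VgS n : good n.+1 (V n) (V n.+1) by exact: (gP (n.+1, V n) (Vnb n)).
exists V; split; last by move=> n; have [_ _ _ []] := VgS n.
split.
- by move=> n; have [W []] := Vg n.
- by move=> n; have [W []] := Vg n.
- by move=> n; have [W [_ _ + _]] := Vg n; apply.
- by move=> n x y; have [_ _ _ [+ _ _]] := VgS n; apply.
- move=> U /(metrizes_nbhs dM)[e e0 eU]; have [n] := ltr_add_invr e0.
  rewrite add0r => ne; exists n => x; have [W [_ _ _ [_ + _]]] := Vg n.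
  by move=> /[apply] /= xn; apply: eU; exact: lt_trans ne.
Qed.

Lemma fast_cauchy (w : nat -> X) : metric_complete d ->
  (forall j, d (w j) (w j.+1) < 2^-1 ^+ j) -> exists l : X, w @ \oo --> l.
Proof.
move=> dc wf; apply: dc => e e0.
have tail m k : d (w m) (w (m + k)%N) <= 2 * 2^-1 ^+ m - 2 * 2^-1 ^+ (m + k).
  elim: k => [|k IH]; first by rewrite addn0 (metrizes_xx dM) subrr.
  apply: le_trans (metrizes_triangle dM _ (w (m + k)%N) _) _.
  have := wf (m + k)%N; rewrite addnS exprS.
  by lra.
have small m : 2 * 2^-1 ^+ m <= 2 * m.+1%:R^-1 :> R.
  rewrite ler_pM2l// exprVn lef_pV2 ?posrE ?exprn_gt0//.
  by rewrite -natrX ler_nat ltn_expl.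
have e40 : 0 < e / 4 by rewrite divr_gt0.
have [N] := ltr_add_invr e40; rewrite add0r => Ne.
have tailN n : (N <= n)%N -> d (w N) (w n) < e / 2.
  move=> /subnKC <-; apply: le_lt_trans (tail _ _) _.
  apply: (@le_lt_trans _ _ (2 * N.+1%:R^-1)); last first.
    by move: (N.+1%:R^-1) Ne => r; lra.
  apply: le_trans (small N); rewrite gerDl oppr_le0.
  by rewrite mulr_ge0// exprn_ge0// invr_ge0.
exists N => m n /tailN Nm /tailN Nn.
apply: le_lt_trans (metrizes_triangle dM _ (w N) _) _.
by rewrite [ltRHS]splitr ltrD// (metrizesC dM).
Qed.

(** Klee's theorem for Abelian groups.  The increments of [x] along a
    subsequence are dealt out alternately to two summands.  Where the
    subsequence may continue is decided when the summand receiving the next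
    increment is already known, so that this increment is small for [d] at that
    summand, although [d] need not be invariant.  Both summands then converge by
    completeness of [d], and so does their sum. *)
Lemma polish_group_complete (V : nat -> set X) (x : nat -> X) :
  metric_complete d -> scale V ->
  (forall n, exists N, forall i j, (N <= i)%N -> (N <= j)%N -> V n (x i - x j)) ->
  exists l : X, x @ \oo --> l.
Proof.
move=> dc sV xC.
have near_incr (u : X) (e : R) (k : nat) : 0 < e -> exists l : nat,
    (k <= l)%N /\ forall m, (l <= m)%N -> d u (u + (x m - x l)) < e.
  move=> e0; have [n nV] := scale_base sV (nbhs_unshift (nbhs_dball dM u e0)).
  have [N NP] := xC n; exists (maxn k N); rewrite leq_maxl; split=> // m lm.
  apply: nV; apply: NP; rewrite ?leq_maxr//.
  by apply: leq_trans lm; rewrite leq_maxr.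
(* state [(u, v, l)]: the next increment, starting at [l], will go to [u] *)
pose inv (j : nat) (s : X * X * nat) :=
  [/\ s.1.1 + s.1.2 = x s.2, (j <= s.2)%N &
      forall m, (s.2 <= m)%N -> d s.1.1 (s.1.1 + (x m - x s.2)) < 2^-1 ^+ j].
have half0 j : 0 < 2^-1 ^+ j :> R by rewrite exprn_gt0// invr_gt0.
have [g gP] : {g : nat * (X * X * nat) -> X * X * nat &
    forall p, inv p.1 p.2 -> [/\ inv p.1.+1 (g p), (g p).1.1 = p.2.1.2 &
      d p.2.1.1 (g p).1.2 < 2^-1 ^+ p.1]}.
  apply: (@choice _ _ (fun p t => inv p.1 p.2 -> [/\ inv p.1.+1 t,
    t.1.1 = p.2.1.2 & d p.2.1.1 t.1.2 < 2^-1 ^+ p.1])) => -[j [[u v] l]] /=.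
  (* [u] is updated up to [l'], and [l'] is chosen with regard to [v] *)
  have [l' [l'l l'P]] := near_incr v _ (maxn l j.+1) (half0 j.+1).
  exists (v, u + (x l' - x l), l') => -[/= uv jl uP]; split=> //; last first.
    by apply: uP; apply: leq_trans l'l; rewrite leq_maxl.
  split=> //=; last by apply: leq_trans l'l; rewrite leq_maxr.
  by rewrite addrCA addrA uv addrC subrK.
have [l0 [_ l0P]] := near_incr 0 _ 0%N (half0 0%N).
pose S := fix S j := if j is i.+1 then g (i, S i) else (0, x l0, l0).
have Sinv j : inv j (S j).
  elim: j => [|j IH]; first by split=> //=; rewrite add0r.
  by have [] := gP (j, S j) IH.
have uS j : (S j.+1).1.1 = (S j).1.2 by have [] := gP (j, S j) (Sinv j).
have vS j : d (S j).1.1 (S j.+1).1.2 < 2^-1 ^+ j.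
  by have [] := gP (j, S j) (Sinv j).
have u2 j : d (S j).1.1 (S j.+2).1.1 < 2^-1 ^+ j by rewrite uS.
have half_le i j : (i <= j)%N -> 2^-1 ^+ j <= 2^-1 ^+ i :> R.
  by move=> ij; rewrite ler_wiXn2l// ?invf_le1// ?ler1n// invr_ge0.
have [a ua] : exists a : X, (fun j => (S j.*2).1.1) @ \oo --> a.
  apply: fast_cauchy => // j; apply: lt_le_trans (u2 _) _; apply: half_le.
  by rewrite -addnn leq_addr.
have [b vb] : exists b : X, (fun j => (S j.*2).1.2) @ \oo --> b.
  apply: fast_cauchy => // j; rewrite -!uS; apply: lt_le_trans (u2 _) _.
  by apply: half_le; rewrite -addnn -addnS leq_addr.
have xab : (fun j => x (S j.*2).2) @ \oo --> a + b.
  have -> : (fun j => x (S j.*2).2) =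
      (fun j => (S j.*2).1.1 + (S j.*2).1.2).
    by apply/funext => j; have [->] := Sinv j.*2.
  exact: (@continuous2_cvg _ _ _ _ _ _ _ _ _ _ _ (add_continuous (a, b)) ua vb).
exists (a + b); apply/(scale_cvg sV) => n.
have [N NP] := xC n.+1; have /(scale_cvg sV)/(_ n.+1)[M MP] := xab.
exists N => m Nm; pose j := maxn M N.
rewrite -[x m - _](subrKA (x (S j.*2).2)).
apply: (scaleD sV); last by apply: MP; rewrite leq_maxl.
apply: NP => //; have [_ + _] := Sinv j.*2; apply: leq_trans.
by rewrite -addnn (leq_trans (leq_maxr M N))// leq_addr.
Qed.

(** If [W] could be covered by finitely many translates of each [V n], every
    ultrafilter on [closure (x + W)] would be Cauchy, hence convergent, and [x]
    would have a compact neighbourhood. *)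
Lemma not_locally_compact_unbounded (V : nat -> set X) W :
  metric_complete d -> scale V -> ~ locally_compact [set: X] ->
  nbhs (0 : X) W ->
  exists2 N, nbhs (0 : X) N & forall U, U `<=` N -> forall s : seq X,
    ~ (forall w, W w -> exists2 y, y \in s & U (w - y)).
Proof.
move=> dc sV nlc W0; apply: contrapT => noN; apply: nlc => x _.
have cover n : exists s : seq X,
    forall w, W w -> exists2 y, y \in s & V n (w - y).
  apply: contrapT => ns; apply: noN; exists (V n); first exact: scale_nbhs.
  move=> U UV s sU; apply: ns; exists s => w /sU[y ys Uy].
  by exists y => //; exact: UV.
pose K := closure [set y | W (y - x)].
exists K.
  rewrite /within /=; have := nbhs_shift x W0.
  by apply: filterS => y Wy _; exact: subset_closure.
split; last exact: closed_closure.
rewrite compact_ultra => F FU FK.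
have pick n : exists y, F [set w | V n (w - y)].
  have [s sW] := cover n.+1.
  have : F [set w | exists2 y, y \in s & V n (w - (x + y))].
    apply: filterS FK => w Kw.
    have [z [Wz /= zw]] := Kw _ (nbhs_shift w (scale_nbhs sV n.+1)).
    have [y ys Vy] := sW _ Wz; exists y => //.
    have -> : w - (x + y) = (z - x - y) - (z - w).
      by rewrite opprB [RHS]addrC -!addrA; congr (_ + _); rewrite addKr opprD.
    exact: (scaleB sV).
  elim: s {sW} => [|y s IH].
    move=> F0; have [w [y]] := @filter_ex _ F _ _ F0.
    by rewrite in_nil.
  move=> Fs; have [Fy|nFy] := in_ultra_setVsetC [set w | V n (w - (x + y))] FU.
    by exists (x + y).
  apply: IH; apply: filterS2 Fs nFy => w [z]; rewrite inE => /orP[/eqP -> //|].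
  by move=> zs Vz _; exists z.
(* the centres of small sets of [F] form a Cauchy sequence, because any two
   sets of [F] meet *)
have [y yP] := choice pick.
have yC n : exists N, forall i j, (N <= i)%N -> (N <= j)%N -> V n (y i - y j).
  exists n.+1 => i j ni nj.
  have [w [wi wj]] := @filter_ex _ F _ _ (filterI (yP i) (yP j)).
  have -> : y i - y j = (w - y j) - (w - y i).
    by rewrite opprB [RHS]addrC subrKA.
  exact: (scaleB sV) (scale_le sV nj wj) (scale_le sV ni wi).
have [l yl] := polish_group_complete dc sV yC.
have Fl : F --> l.
  move=> A /nbhs_unshift/(scale_base sV)[n nA].
  have /(scale_cvg sV)/(_ n.+1)[N NP] := yl.
  apply: filterS (yP (maxn N n.+1)) => w wy.
  rewrite -(subrK l w) addrC; apply: nA.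
  rewrite -(subrKA (y (maxn N n.+1))); apply: (scaleD sV).
    by apply: scale_le wy => //; rewrite leq_maxr.
  by apply: NP; rewrite leq_maxl.
exists l; split=> //.
apply: closed_closure => A /Fl FA.
by have [w [? ?]] := @filter_ex _ F _ _ (filterI FK FA); exists w.
Qed.

End PolishGroup.

(** * Moving compact sets apart *)

Definition unbounded_scale (X : topologicalZmodType) (V : nat -> set X) :=
  forall n (s : seq X), ~ (forall w, V n w -> exists2 y, y \in s & V n.+1 (w - y)).

(** A first, arbitrary scale is needed to speak of Cauchy sequences. *)
Lemma unbounded_scale_exists (R : realType) (X : topologicalZmodType) :
  polish R X -> ~ locally_compact [set: X] ->
  exists V : nat -> set X, scale V /\ unbounded_scale V.
Proof.
move=> [_ [d [dM dc]]] nlc.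
have [|V0 [sV0 _]] := @scale_exists _ _ _ dM (fun _ _ => True).
  by move=> W W0; exists W.
apply: (@scale_exists _ _ _ dM (fun W U => forall s : seq X,
  ~ (forall w, W w -> exists2 y, y \in s & U (w - y)))).
move=> W W0; have [N N0 NP] := not_locally_compact_unbounded dM dc sV0 nlc W0.
by exists N.
Qed.

Section Translates.
Variables (X : topologicalZmodType) (V : nat -> set X).
Hypothesis sV : scale V.

(** The vectors are chosen one after the other.  The next one must avoid
    [V a.+2]-neighbourhoods of finitely many compact sets [v i + Q i - Q j], which
    are covered by finitely many translates of [V a.+1]; these cannot exhaust
    [V a]. *)
Lemma spread a (Q : nat -> set X) :
  unbounded_scale V -> (forall j, compact (Q j)) ->
  exists v : nat -> X, (forall j, V a (v j)) /\
    forall i j q q', i != j -> Q i q -> Q j q' ->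
      ~ V a.+2 ((v i + q) - (v j + q')).
Proof.
move=> uV Qc.
have [f fP] : {f : seq X -> X & forall p : seq X, V a (f p) /\
    forall i q q', (i < size p)%N -> Q i q -> Q (size p) q' ->
      ~ V a.+2 ((p`_i + q) - (f p + q'))}.
  apply: (@choice _ _ (fun p w => V a w /\
    forall i q q', (i < size p)%N -> Q i q -> Q (size p) q' ->
      ~ V a.+2 ((p`_i + q) - (w + q')))) => p.
  apply: contrapT => nw.
  have [s sP] : {s : nat -> seq X & forall i q q', Q i q -> Q (size p) q' ->
      exists2 y, y \in s i & V a.+2 ((p`_i + (q - q')) - y)}.
    apply: (@choice _ _ (fun i s => forall q q', Q i q -> Q (size p) q' ->
      exists2 y, y \in s & V a.+2 ((p`_i + (q - q')) - y))) => i.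
    have Kc : compact ((fun r : X * X => p`_i + (r.1 - r.2)) @`
        (Q i `*` Q (size p))).
      apply: continuous_compact; last exact: compact_setX.
      apply: continuous_subspaceT => r.
      apply: (@continuous_comp _ _ _ (fun r : X * X => r.1 - r.2)).
        exact: sub_continuous.
      exact: shift_continuous.
    have [s [_ sP]] := compact_net Kc (fun x _ => nbhs_shift x (scale_nbhs sV a.+2)).
    exists s => q q' Qq Qq'.
    have [|y ys Vy] := sP (p`_i + (q - q')); first by exists (q, q').
    by exists y.
  apply: (uV a (flatten [seq s i | i <- iota 0 (size p)])) => w Vw.
  apply: contrapT => nwy; apply: nw; exists w; split=> // i q q' ip Qq Qq' Vpw.
  have [y ys Vy] := sP i q q' Qq Qq'; apply: nwy; exists y.
    by apply/flatten_mapP; exists i; rewrite ?mem_iota ?ys.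
  have Epw : p`_i + q - (w + q') = p`_i + (q - q') - w.
    by rewrite opprD [- w - _]addrC !addrA.
  rewrite -(subrKA (p`_i + (q - q'))) addrC -[w - _]opprB -Epw.
  exact: (scaleB sV).
pose pre := fix pre j := if j is i.+1 then rcons (pre i) (f (pre i)) else [::].
have size_pre j : size (pre j) = j by elim: j => //= j; rewrite size_rcons => ->.
have nth_pre i j : (i < j)%N -> (pre j)`_i = f (pre i).
  elim: j => // j IH; rewrite ltnS /= nth_rcons size_pre leq_eqVlt.
  by case: ltngtP => //= [ij _|-> _]; [exact: IH|].
have lt_spread i j q q' : (i < j)%N -> Q i q -> Q j q' ->
    ~ V a.+2 ((f (pre i) + q) - (f (pre j) + q')).
  move=> ij; have [_ /(_ i q q')] := fP (pre j).
  by rewrite size_pre nth_pre//; apply.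
exists (f \o pre); split=> [j|i j q q']; first by have [] := fP (pre j).
rewrite neq_ltn => /orP[ij|ji] Qq Qq'; first exact: lt_spread.
by move=> /(scaleN sV); rewrite opprB; exact: lt_spread.
Qed.

(** [F t] is the sum over [n] of the vectors numbered [c n t] in families
    obtained from [spread] with [a = 6 n + 1].  Two points are separated at the
    first level [n] where their codes differ.  There the chosen vectors keep
    the approximations [r n] apart by [V (6 n + 3)], whereas the tail of each
    series and the error of each approximation contribute only members of
    [V (6 n + 5)] and [V (6 n + 6)]. *)
Lemma separated_translates (R : realType) (T : Type) (c : nat -> T -> nat)
    (K : T -> set X) (r : nat -> nat -> set X) :
  polish R X -> unbounded_scale V ->
  (forall t t', (forall n, c n t = c n t') -> t = t') ->
  (forall n k, compact (r n k)) ->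
  (forall n t x, K t x -> exists2 y, r n (c n t) y & V (6 * n + 6) (x - y)) ->
  exists F : T -> X,
    (forall n, exists m, forall t t',
       (forall i, (i < m)%N -> c i t = c i t') -> V n (F t - F t')) /\
    (forall t t' x x', K t x -> K t' x' -> x + F t = x' + F t' -> t = t').
Proof.
move=> [_ [d [dM dc]]] uV cI rc Kr.
have [g gP] := choice (fun n => spread (6 * n).+1 uV (rc n)).
have gV n j : V (6 * n).+1 (g n j) by have [] := gP n.
pose P t n := \sum_(0 <= i < n) g i (c i t).
have PS t n : P t n.+1 = P t n + g n (c n t) by rewrite /P big_nat_recr.
have tail t m k : V (6 * m) (P t (m + k)%N - P t m).
  elim: k m => [|k IH] m; first by rewrite addn0 subrr; exact: scale0.
  rewrite addnS -addSn -(subrKA (P t m.+1)); apply: (scaleD sV).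
    by apply: scale_le (IH _) => //; rewrite mulnS -addn1 addnC leq_add2r.
  by rewrite PS addrC addKr.
have tail_le t m n : (m <= n)%N -> V (6 * m) (P t n - P t m).
  by move=> mn; rewrite -(subnKC mn).
have [F Fl] : {F : T -> X & forall t, P t @ \oo --> F t}.
  apply: (@choice _ _ (fun t l => P t @ \oo --> l)) => t.
  apply: (polish_group_complete dM dc sV) => n; exists n.+1 => i j ni nj.
  rewrite -(subrKA (P t n.+1)) -[P t n.+1 - _]opprB.
  have le6 : (n.+1 <= 6 * n.+1)%N by rewrite leq_pmull.
  by apply: (scaleB sV); apply: scale_le (tail_le _ _ _ _).
have Ftail t m : V (6 * m + 5)%N (F t - P t m.+1).
  have /(scale_cvg sV)/(_ (6 * m.+1)%N)[N NP] := Fl t.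
  pose n := maxn N m.+1; rewrite -(subrKA (P t n)).
  have e6 : (6 * m.+1)%N = (6 * m + 5).+1 by rewrite mulnS addnC addnS.
  apply: (scaleD sV); rewrite -e6; last by apply: tail_le; rewrite leq_maxr.
  by rewrite -opprB; apply: scaleN => //; apply: NP; rewrite leq_maxl.
have Peq t t' m : (forall i, (i < m)%N -> c i t = c i t') -> P t m = P t' m.
  by move=> tt; apply: eq_big_nat => i /andP[_ im]; rewrite tt.
exists F; split=> [n|t t' x x' Kx Kx' xx'].
  exists n.+1 => t t' /Peq tt.
  rewrite -(subrKA (P t n.+1)) -[P t n.+1 - F t']opprB [in F t' - _]tt.
  apply: (@scale_le _ _ sV _ (6 * n + 4)).
    by rewrite (leq_trans _ (leq_addr _ _))// leq_pmull.
  by apply: (scaleB sV); rewrite -addnS; exact: Ftail.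
apply: cI; apply: contrapT => /existsNP ctt.
have ex : exists n, c n t != c n t' by have [n /eqP] := ctt; exists n.
case: (ex_minnP ex) => n nn nmin.
have Pn : P t n = P t' n.
  apply: Peq => i ilt; apply/eqP; apply: contraTT ilt => /nmin.
  by rewrite -leqNgt.
have [y ry xy] := Kr n t x Kx; have [y' ry' xy'] := Kr n t' x' Kx'.
have [_ /(_ (c n t) (c n t') y y' nn ry ry')] := gP n; apply.
have abel (p a b e t1 a' b' e' t1' : X) :
    (b + e) + ((p + a) + t1) = (b' + e') + ((p + a') + t1') ->
    (a + b) - (a' + b') = (e' + t1') - (e + t1).
  rewrite [LHS](AC (2*(2*1)) (3*((4*1)*(2*5)))).
  rewrite [RHS](AC (2*(2*1)) (3*((4*1)*(2*5)))) => /addrI abE.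
  apply/eqP; rewrite subr_eq addrAC eq_sym subr_eq eq_sym.
  by rewrite [(_ + _) + (a' + b')]addrC; apply/eqP.
have Fsplit s : F s = (P s n + g n (c n s)) + (F s - P s n.+1).
  by rewrite PS addrC subrK.
have errV s z w : V (6 * n + 6)%N (z - w) ->
    V (6 * n + 4)%N ((z - w) + (F s - P s n.+1)).
  move=> zw; apply: (scaleD sV); rewrite -addnS; last exact: Ftail.
  by apply: scale_le zw => //; rewrite leq_add2l.
move: xx'; rewrite (Fsplit t) (Fsplit t') -Pn.
rewrite -{1}(subrKC y x) -{1}(subrKC y' x') => /abel ->.
have -> : (6 * n).+3 = (6 * n + 3)%N by rewrite addnC.
by apply: (scaleB sV); rewrite -addnS; exact: errV.
Qed.

End Translates.

(** * Borel maps defined through codes *)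

Section CodedBorel.
Variables (S : topologicalType) (X : topologicalZmodType) (V : nat -> set X).
Hypothesis sV : scale V.

(** For a finite code [p], let [W p] be the largest open set of values of [pi]
    that are sent into [U] on the whole cylinder of [p].  As [F] varies little on
    long cylinders, the preimage of [U] is the union over the countably many [p]
    of the cylinder of [p] intersected with the preimage of [W p]. *)
Lemma coded_borel (pi F : S -> X) (c : nat -> S -> nat) :
  continuous pi ->
  (forall n k, <<s @open S >> [set s | c n s = k]) ->
  (forall n, exists m, forall s s',
     (forall i, (i < m)%N -> c i s = c i s') -> V n (F s - F s')) ->
  borel_map (fun s => pi s + F s).
Proof.
move=> pic cB cF; apply: borel_map_open => U oU.
pose cyl n (p : nat -> nat) := [set s | forall i, (i < n)%N -> c i s = p i].
have cylB n p : <<s @open S >> (cyl n p).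
  elim: n => [|n IH].
    rewrite (_ : cyl _ _ = setT); first by apply: borel_open; exact: openT.
    by apply/seteqP; split=> // s _ i.
  rewrite (_ : cyl n.+1 p = cyl n p `&` [set s | c n s = p n]).
    exact: borelI.
  apply/seteqP; split=> [s sp|s [sp sn] i].
    by split=> [i ilt|]; apply: sp => //; exact: ltnW.
  by rewrite ltnS leq_eqVlt => /orP[/eqP ->|] //; exact: sp.
pose cyls (p : seq nat) := cyl (size p) (nth 0%N p).
pose W p := [set x | exists O, [/\ open O, O x &
  forall s x', cyls p s -> O x' -> U (x' + F s)]].
have Wo p : open (W p).
  rewrite openE => x [ O [oO Ox OU]]; rewrite /interior.
  have : nbhs x O by exact: open_nbhs_nbhs.
  by apply: filterS => y Oy; exists O.
rewrite (_ : _ @^-1` U = \bigcup_(p : seq nat) (cyls p `&` pi @^-1` W p)).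
  apply: borel_bigcup => p; apply: borelI; first exact: cylB.
  by apply: borel_open; apply: open_comp => // s _; exact: pic.
apply/seteqP; split=> [s Us|s [p _ [ps [ O [oO Os OU]]]]]; last exact: OU.
have [n nU] := scale_base sV (nbhs_unshift (open_nbhs_nbhs (conj oU Us))).
have [m mP] := cF n.+1.
have szm : size (mkseq (c^~ s) m) = m by rewrite size_mkseq.
exists (mkseq (c^~ s) m) => //; split.
  by move=> i; rewrite szm => im; rewrite nth_mkseq.
exists [set x | V n.+1 (x - pi s)]; split.
- have := scale_open sV n.+1; apply: open_comp => x _.
  rewrite (_ : (fun x => x - pi s) = +%R (- pi s)); first exact: shift_continuous.
  by apply/funext => y; rewrite addrC.
- by rewrite /= subrr; exact: scale0.
- move=> s' x' s'c Vx'; have Fs : V n.+1 (F s' - F s).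
    by apply: mP => i im; rewrite s'c ?szm// nth_mkseq.
  have := nU _ (scaleD sV Vx' Fs).
  by rewrite /= addrACA !subrKC.
Qed.

End CodedBorel.

Lemma scale_eq0 (X : topologicalZmodType) (V : nat -> set X) (x : X) :
  scale V -> hausdorff_space X -> (forall n, V n x) -> x = 0.
Proof.
move=> sV hX Vx; apply/esym/hX => A B /(scale_base sV)[n nA] Bx.
by exists x; split; [exact: nA|exact: nbhs_singleton].
Qed.

Lemma borel_first (T : topologicalType) (A : nat -> set T) (i : T -> nat) :
  (forall n, <<s @open T >> (A n)) -> (forall x, A (i x) x) ->
  (forall x n, A n x -> (i x <= n)%N) ->
  forall n, <<s @open T >> [set x | i x = n].
Proof.
move=> AB Ai imin n.
rewrite (_ : mkset _ = A n `&` ~` \bigcup_k (if (k < n)%N then A k else set0)).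
  apply: borelI => //; apply: borelC; apply: borel_bigcup => k; case: ifP => // _.
  exact: borel_open open0.
apply/seteqP; split=> [x <-|x [An nA]].
  split=> // -[k _]; case: ifP => // klt /imin; by rewrite leqNgt klt.
apply/eqP; rewrite eqn_leq imin//= leqNgt; apply/negP => lt.
by apply: nA; exists (i x); rewrite ?lt.
Qed.

(** * Disjoint translates of images of continuous maps *)

Lemma continuous_pair (S T U : topologicalType) (f : S -> T) (g : S -> U) :
  continuous f -> continuous g -> continuous (fun x => (f x, g x)).
Proof. by move=> fc gc x; exact: cvg_pair (fc x) (gc x). Qed.

Lemma continuous_fst (S T : topologicalType) : continuous (@fst S T).
Proof. by move=> x; exact: cvg_fst. Qed.

Lemma continuous_snd (S T : topologicalType) : continuous (@snd S T).
Proof. by move=> x; exact: cvg_snd. Qed.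

Lemma continuousT_comp (S T U : topologicalType) (f : S -> T) (g : T -> U) :
  continuous f -> continuous g -> continuous (g \o f).
Proof. by move=> fc gc x; apply: continuous_comp; [exact: fc|exact: gc]. Qed.

Section HaarSets.
Import ArrowAsCompactOpen.
Variables (R : realType) (Z : topologicalType) (X : topologicalZmodType).
Hypotheses (Z0 : [set: Z] !=set0) (Zc : compact [set: Z])
  (Zm : metrizable R Z) (Xp : polish R X).
Local Notation C := (continuousType Z X).

Let hX : hausdorff_space X. Proof. exact: polish_hausdorff Xp. Qed.

Let Cp : polish R C. Proof. exact: polish_continuousType. Qed.

Lemma eval_cts : continuous (fun p : Z * C => p.2 p.1).
Proof. by have [_ [d [dM _]]] := Xp; exact: eval_compact_continuous dM. Qed.

Lemma open_uniformly_close (O : set X) (g : C) :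
  open O -> open [set h : C | forall z, O (g z - h z)].
Proof.
move=> oO; apply: (tube_open (P := [set p : Z * C | O (g p.1 - p.2 p.1)]) Zc).
move: oO; apply: open_comp => p _; move: p.
have cg : continuous (fun p : Z * C => g p.1).
  exact: continuousT_comp (@continuous_fst _ _) (@cts_fun _ _ g).
exact: continuousT_comp (continuous_pair cg eval_cts) (@sub_continuous X).
Qed.

(** The code of [(h, y)] at level [n] consists of the least [k] such that [h] is
    uniformly close to the [k]-th term of a dense sequence of maps, and of [y n].
    It depends continuously on [y] and in a Borel way on [h], and all codes
    together determine [(h, y)]. *)
Lemma compact_translates (L : set X) :
  ~ locally_compact [set: X] -> compact L ->
  exists t : C * cantor_space -> X,
    [/\ forall h, continuous (fun y => t (h, y)),
        borel_map (fun p : C * cantor_space * X => p.2 + t p.1)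
      & forall (s s' : C * cantor_space) z z' l l', L l -> L l' ->
          s.1 z + l + t s = s'.1 z' + l' + t s' -> s = s'].
Proof.
move=> nlc Lc; have [V [sV uV]] := unbounded_scale_exists Xp nlc.
have [h_ hP] : exists h_ : nat -> C, forall n (h : C), exists k,
    forall z, V n (h_ k z - h z).
  have [[D [Dc Dd]] _] := Cp.
  have c0 : continuous (fun _ : Z => 0 : X) by move=> z; exact: cvg_cst.
  have [h_ h_D] := countable_sequence (mkcts c0 : C) Dc.
  exists h_ => n h; have oh := open_uniformly_close h (scale_open sV n).
  have [|f [fP Df]] := Dd _ _ oh.
    by exists h => z; rewrite subrr; exact: scale0.
  have [k kf] := h_D _ Df; exists k => z; rewrite kf -opprB.
  by apply: (scaleN sV); exact: fP.
pose A n k := [set h : C | forall z, V (6 * n + 6)%N (h_ k z - h z)].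
have exA n h : exists k, `[< A n k h >].
  by have [k kP] := hP (6 * n + 6)%N h; exists k; apply/asboolP.
pose i n h := ex_minn (exA n h).
have iA n h : A n (i n h) h by rewrite /i; case: ex_minnP => k /asboolP.
have imin n h k : A n k h -> (i n h <= k)%N.
  by move=> Ak; rewrite /i; case: ex_minnP => m _; apply; apply/asboolP.
have Ao n k : open (A n k) by apply: open_uniformly_close; exact: scale_open.
pose c n (s : C * cantor_space) : nat := pickle (i n s.1, s.2 n).
have cP n s s' : c n s = c n s' -> i n s.1 = i n s'.1 /\ s.2 n = s'.2 n.
  by move=> /(pcan_inj (@pickleK _)) [].
pose K (s : C * cantor_space) := [set x | exists z l, L l /\ x = s.1 z + l].
pose r (n k : nat) := if (unpickle k : option (nat * bool)) is Some ab
  then [set x | exists z l, L l /\ x = h_ ab.1 z + l] else set0.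
have [|||t [tc tI]] := @separated_translates _ _ sV R _ c K r Xp uV.
- move=> [h y] [h' y'] cc; congr pair; last first.
    by apply/funext => n; have [] := cP _ _ _ (cc n).
  apply/continuousEP => z; apply/eqP; rewrite -subr_eq0; apply/eqP.
  apply: (scale_eq0 sV hX) => n; have [ii _] := cP _ _ _ (cc n).
  rewrite -(subrKA (h_ (i n h) z)) addrC -[h z - _]opprB.
  have := iA n h z; have := iA n h' z; rewrite -[i n h']ii /= => Vh' Vh.
  apply: (@scale_le _ _ sV _ (6 * n + 5)%N).
    by rewrite (leq_trans _ (leq_addr _ _))// leq_pmull.
  by apply: (scaleB sV); rewrite -addnS.
- move=> n k; rewrite /r; case: (unpickle k) => [ab|]; last exact: compact0.
  rewrite (_ : mkset _ =
      (fun p : X * X => p.1 + p.2) @` ((h_ ab.1 @` [set: Z]) `*` L)).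
    apply: continuous_compact.
      by apply: continuous_subspaceT; exact: add_continuous.
    apply: compact_setX => //; apply: continuous_compact => //.
    by apply: continuous_subspaceT; exact: cts_fun.
  apply/seteqP; split=> [_ [z [l [Ll ->]]]|_ [[x l] [/= [z _ <-] Ll] <-]].
    by exists (h_ ab.1 z, l) => //; split => //; exists z.
  by exists z, l.
- move=> n [h y] _ [z [l [Ll ->]]]; exists (h_ (i n h) z + l).
    by rewrite /r /c pickleK; exists z, l.
  rewrite /= [- (_ + _)]opprD addrACA subrr addr0 -opprB.
  by apply: (scaleN sV); exact: iA.
exists t; split.
- move=> h y B /= /nbhs_unshift/(scale_base sV)[n nB].
  have [m mP] := tc n; apply/cantor_nbhs; exists m => y' yy'.
  rewrite /= -(subrKC (t (h, y)) (t (h, y'))); apply: nB; apply: mP => k km.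
  by rewrite /c /= yy'.
- apply: (@coded_borel _ _ _ sV snd (t \o fst) (fun n p => c n p.1)).
  + by move=> p; exact: cvg_snd.
  + move=> n k; rewrite (_ : mkset _ = \bigcup_(ab : nat * bool)
      (if pickle ab == k then [set p : C * cantor_space * X | i n p.1.1 = ab.1]
         `&` [set p | p.1.2 n = ab.2] else set0)).
      apply: borel_bigcup => -[a b]; case: ifP => _; last exact: borel_open open0.
      apply: borelI.
        have c11 : continuous (fun p : C * cantor_space * X => p.1.1).
          by move=> p; apply: continuous_comp; exact: cvg_fst.
        apply: (continuous_borel_map c11 (B := [set h | i n h = a])).
        have AB m : <<s @open C >> (A n m) by exact: borel_open.
        exact: borel_first AB (iA n) (imin n) a.
      apply: borel_open.
      have : open [set b] by exact: discrete_open.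
      apply: (@open_comp _ _ (fun p : C * cantor_space * X => p.1.2 n)) => p _.
      apply: (@continuous_comp _ _ _ (fun p : C * cantor_space * X => p.1.2)
        (fun y : cantor_space => y n)).
        by apply: continuous_comp; [exact: cvg_fst|exact: cvg_snd].
      exact: (@proj_continuous nat (fun=> bool : topologicalType) n).
    apply/seteqP; split=> [p <-|p [[a b] _]].
      by exists (i n p.1.1, p.1.2 n) => //; rewrite /c eqxx.
    by case: eqP => // <- [/= pa pb]; rewrite /c pa pb.
  + by move=> n; have [m mP] := tc n; exists m => p p'; exact: mP.
- move=> s s' z z' l l' Ll Ll' ss; apply: tI ss; first by exists z, l.
  by exists z', l'.
Qed.

Lemma graph_closed :
  closed [set p : C * cantor_space * X | exists z, p.1.1 z = p.2].
Proof.
rewrite -openC (_ : ~` _ = [set p : C * cantor_space * X | forall z,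
    p.1.1 z - p.2 != 0]); last first.
  apply/seteqP; split=> [p np z|p np [z pz]].
    by apply/negP; rewrite subr_eq0 => /eqP pz; apply: np; exists z.
  by have := np z; rewrite pz subrr eqxx.
apply: (tube_open (P := [set q : Z * (C * cantor_space * X) |
  q.2.1.1 q.1 - q.2.2 != 0]) Zc).
have o0 : open (~` [set (0 : X)]).
  by rewrite openC; apply: compact_closed => //; exact: compact_set1.
pose f (q : Z * (C * cantor_space * X)) : X := q.2.1.1 q.1 - q.2.2.
rewrite (_ : [set q | f q != 0] = f @^-1` (~` [set 0])); last first.
  by apply/seteqP; split=> q /= /eqP.
move: o0; apply: open_comp => q _; move: q.
have c21 : continuous (fun q : Z * (C * cantor_space * X) => q.2.1.1).
  exact: (continuousT_comp (@continuous_snd Z (C * cantor_space * X)%type)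
    (continuousT_comp (@continuous_fst _ _) (@continuous_fst _ _))).
have c22 : continuous (fun q : Z * (C * cantor_space * X) => q.2.2).
  exact: continuousT_comp (@continuous_snd _ _) (@continuous_snd _ _).
have ce : continuous (fun q : Z * (C * cantor_space * X) => q.2.1.1 q.1).
  exact: continuousT_comp (continuous_pair (@continuous_fst _ _) c21) eval_cts.
exact: continuousT_comp (continuous_pair ce c22) (@sub_continuous X).
Qed.

(** Disjointness of the translates of a fixed image makes [t (h, -)] injective. *)
Lemma cantor_in_group :
  ~ locally_compact [set: X] ->
  exists k : cantor_space -> X, continuous k /\ injective k.
Proof.
move=> nlc; have [z _] := Z0.
have [t [tc _ tI]] := compact_translates nlc (@compact_set1 X 0).
have c0 : continuous (fun _ : Z => 0 : X) by move=> z'; exact: cvg_cst.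
exists (fun y => t (mkcts c0 : C, y)); split=> [|y y' tyy']; first exact: tc.
have [] // : (mkcts c0 : C, y) = (mkcts c0 : C, y').
by apply: (tI _ _ z z 0 0) => //=; rewrite tyy'.
Qed.

(** * The diagonal set *)

Variables (I : set (set Z)) (Gam Lam : setclass).
Hypotheses (Is : semi_ideal I) (Ic : \bigcup_(A in I) A = [set: Z])
  (Gp : is_pointclass R Gam) (Lp : is_pointclass R Lam)
  (GLH : propertyH R I Gam Lam).
Arguments Gam : clear implicits.
Arguments Lam : clear implicits.

(** The inclusion of a closed subspace is a Borel injection of a Polish space. *)
Lemma pointclass_closed (T : topologicalType) (A : set T) :
  polish R T -> closed A -> Gam T A.
Proof.
move=> Tp Acl; have Ap := polish_closed Tp Acl.
have -> : A = (set_val : A -> T) @` [set: A].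
  apply/seteqP; split=> [x Ax|_ [x _ <-]]; last exact: set_valP.
  by exists (exist _ x (mem_set Ax)); rewrite ?set_valE.
apply: (propertyH5 GLH) => //.
- by apply: continuous_borel_map; exact: initial_continuous.
- by have [_ /(_ _ Ap)[]] := Gp.
Qed.

Let I_subset1 (S : set Z) : is_subset1 S -> I S.
Proof.
have [[A0 IA0] Isub] := Is => S1.
have [[z Sz]|nS] := pselect (exists z, S z); last first.
  by apply: Isub IA0 => z Sz; case: nS; exists z.
have [A IA Az] : (\bigcup_(A in I) A) z by rewrite Ic.
by apply: Isub IA => z' /S1 /(_ Sz) ->.
Qed.

(** The triples to be uniformized.  The code [y] also occurs as an argument of
    the set that it codes, since that set will be defined in terms of [t (h, y)].
    Restricting [g] to values of [h] does not change preimages under [h], and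
    confines [E] to the disjoint translates. *)
Let candidates (U : set (cantor_space * (cantor_space * X))) :=
  [set p : C * cantor_space * X |
    [/\ exists z, p.1.1 z = p.2, U (p.1.2, (p.1.2, p.2)) &
        ~ I [set z | U (p.1.2, (p.1.2, p.1.1 z))]]].

Lemma pointclass_candidates U : Gam _ U -> Gam _ (candidates U).
Proof.
move=> GU; have [Gpre Gops] := Gp.
have CKp : polish R (C * cantor_space)%type.
  by apply: polish_prod => //; exact: cantor_polish.
have CKXp : polish R (C * cantor_space * X)%type by exact: polish_prod.
have Zp : polish R Z by exact: polish_compact.
have KKXp : polish R (cantor_space * (cantor_space * X))%type.
  by do 2![apply: polish_prod => //; try exact: cantor_polish].
have [_ _ GI] := Gops _ CKXp.
pose q2 (p : C * cantor_space * X) := (p.1.2, (p.1.2, p.2)).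
pose J (q : C * cantor_space) := ~ I [set z | U (q.2, (q.2, q.1 z))].
rewrite (_ : candidates U = [set p : C * cantor_space * X | exists z, p.1.1 z = p.2] `&`
   (q2 @^-1` U `&` fst @^-1` [set q | J q])); last first.
  by apply/seteqP; split=> p [] //= ? [].
have cy : continuous (fun p : C * cantor_space * X => p.1.2).
  exact: continuousT_comp (@continuous_fst _ _) (@continuous_snd _ _).
apply: (GI _ _ _ _).1; first exact: pointclass_closed graph_closed.
apply: (GI _ _ _ _).1.
  apply: (Gpre _ _ q2 U) => //.
  by do 2!apply: continuous_pair => //; exact: continuous_snd.
apply: (Gpre _ _ fst [set q | J q]) => //.
  exact: continuous_fst.
pose B := [set q : Z * (C * cantor_space) | U (q.2.2, (q.2.2, q.2.1 q.1))].
have GB : Gam _ B.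
  apply: (Gpre _ _ (fun q : Z * (C * cantor_space) =>
    (q.2.2, (q.2.2, q.2.1 q.1))) U) => //; first exact: polish_prod.
  have c22 : continuous (fun q : Z * (C * cantor_space) => q.2.2).
    exact: continuousT_comp (@continuous_snd _ _) (@continuous_snd _ _).
  have c21 : continuous (fun q : Z * (C * cantor_space) => q.2.1).
    exact: continuousT_comp (@continuous_snd _ _) (@continuous_fst _ _).
  do 2!apply: continuous_pair => //.
  exact: continuousT_comp (continuous_pair (@continuous_fst _ _) c21) eval_cts.
have := propertyH3 GLH CKp GB; rewrite /dual_class /=.
suff -> : ~` [set q | I (ysection B q)] = [set q | J q] by [].
apply/seteqP; split=> q; rewrite /J /=; suff -> // : ysection B q =
  [set z | U (q.2, (q.2, q.1 z))] by []; apply/seteqP.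
- by split=> z; rewrite /ysection /= inE.
- by split=> z; rewrite /ysection /= inE.
Qed.

Lemma haar1_set_without_hull :
  (exists e : Z -> X, topological_embedding e) ->
  ~ locally_compact [set: X] ->
  exists E : set X,
    [/\ Gam X E, haar1 E, haar I E
      & ~ exists H : set X, [/\ Lam X H, haar I H & E `<=` H]].
Proof.
move=> [e [eI ec _]] nlc; have [k [kc kI]] := cantor_in_group nlc.
have [Gpre Gops] := Gp.
have [z0 _] := Z0.
pose L := range e `|` range k.
have Lc : compact L.
  apply: compactU; apply: continuous_compact => //.
  - exact: continuous_subspaceT.
  - exact: continuous_subspaceT.
  - exact: cantor_space_compact.
(* the vectors are adapted to [L] so that both [e] and [k] can serve as
   witnesses of smallness of [E] *)
have [t [tc tB tI]] := compact_translates nlc Lc.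
have KXp : polish R (cantor_space * X)%type.
  by apply: polish_prod => //; exact: cantor_polish.
have CKXp : polish R (C * cantor_space * X)%type.
  by do 2![apply: polish_prod => //]; exact: cantor_polish.
have [U [GU Uuniv]] := propertyH2 GLH KXp.
have [phi [Gphi phiA phi1]] : has_uniformization Gam (candidates U).
  apply: (propertyH4 GLH Xp (cantor_polish R)); first exact: pointclass_candidates.
  move=> h y; have [Ih|nIh] := pselect (I [set z | U (y, (y, h z))]).
    by left; apply/seteqP; split=> // g; rewrite /xsection /= inE => -[].
  right; rewrite (_ : _ @^-1` _ = [set z | U (y, (y, h z))]) //.
  apply/seteqP; split=> z; rewrite /xsection /= inE; first by case.
  by move=> Uz; split=> //; exists z.
have phi_uniq s g g' : phi (s, g) -> phi (s, g') -> g = g'.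
  case: s => h y pg pg'.
  have [|x0 px0] := phi1 (h, y).
    by exists g; rewrite /xsection /= inE; exact: phiA.
  have px g1 : phi ((h, y), g1) -> g1 = x0.
    move=> p1; suff : xsection phi (h, y) g1 by rewrite px0.
    by rewrite /xsection /= inE.
  by rewrite (px _ pg) (px _ pg').
pose Y := [set p : C * cantor_space * X | exists z, p.1.1 z = p.2].
have Ycl : closed Y by exact: graph_closed.
have Yp : polish R Y by exact: polish_closed.
pose f (p : Y) : X := (val p).2 + t (val p).1.
pose E := f @` (val @^-1` phi).
have EP x : E x -> exists (s : C * cantor_space) z,
    phi (s, s.1 z) /\ x = s.1 z + t s.
  move=> [p pp <-]; pose q : C * cantor_space * X := val p.
  have [z pz] : exists z, q.1.1 z = q.2 by exact: set_valP p.
  exists q.1, z; rewrite pz; split=> [|//].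
  by have : phi q := pp; case: (q).
have PE s g : phi (s, g) -> E (g + t s).
  move=> p; have Yp' : Y (s, g) by have [] := phiA _ p.
  by exists (exist _ (s, g) (mem_set Yp')).
have Esep x x' l l' : E x -> E x' -> L l -> L l' -> x + l = x' + l' -> x = x'.
  move=> /EP[s [z [ps ->]]] /EP[s' [z' [ps' ->]]] Ll Ll' xx.
  have ss : s = s'.
    by apply: (tI s s' z z' l l' Ll Ll'); rewrite addrAC xx addrAC.
  by move: ps'; rewrite -ss => /(phi_uniq _ _ _ ps) ->.
have Ehaar (T : Type) (f0 : T -> X) : injective f0 -> (forall u, L (f0 u)) ->
    forall x, is_subset1 (f0 @^-1` [set a + x | a in E]).
  move=> f0I f0L x u u' [a Ea au] [a' Ea' au']; apply: f0I.
  suff aa : a = a' by rewrite -au -au' aa.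
  apply: (Esep a a' (f0 u') (f0 u)) => //.
  by rewrite -au -au' addrCA.
exists E; split.
- have fI : injective f.
    move=> p p'; pose q : C * cantor_space * X := val p.
    pose q' : C * cantor_space * X := val p'.
    have [z pz] : exists z, q.1.1 z = q.2 by exact: set_valP p.
    have [z' pz'] : exists z, q'.1.1 z = q'.2 by exact: set_valP p'.
    move=> ff; have {ff} qq : q.2 + t q.1 = q'.2 + t q'.1 := ff.
    have Lz0 : L (e z0) by left; exists z0.
    have ss : q.1 = q'.1.
      apply: (tI _ _ z z' (e z0) (e z0)) => //.
      by rewrite pz pz' [LHS]addrAC qq [RHS]addrAC.
    apply: val_inj; rewrite -[LHS]/q -[RHS]/q'.
    move: qq ss; case: (q) (q') => [s g] [s' g'] /= + ss; rewrite ss.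
    by move=> /addIr ->.
  have fB : borel_map f.
    move=> B /tB BB.
    exact: (continuous_borel_map (@initial_continuous _ _ (set_val : Y -> _)) BB).
  apply: (propertyH5 GLH Yp Xp fI fB).
  apply: (Gpre _ _ (set_val : Y -> _)) => // x.
  exact: initial_continuous.
- exists k; split=> //; apply: Ehaar => // u; by right; exists u.
- exists e; split=> // x; apply: I_subset1; apply: Ehaar => // u.
  by left; exists u.
move=> [H [LH [h [hc hH]] EH]].
pose hC : C := mkcts hc.
have [y Uy] : exists y, xsection U y = [set q | ~ H (q.2 + t (hC, q.1))].
  apply: Uuniv; rewrite /dual_class /=.
  have [Lpre _] := Lp.
  rewrite (_ : ~` _ = (fun q : cantor_space * X => q.2 + t (hC, q.1)) @^-1` H).
    apply: Lpre => //; apply: (continuousT_comp (f := fun q : cantor_space * X =>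
      (q.2, t (hC, q.1))) (g := fun q : X * X => q.1 + q.2)).
      apply: continuous_pair; first exact: continuous_snd.
      exact: (continuousT_comp (@continuous_fst cantor_space X) (tc hC)).
    exact: add_continuous.
  by apply/seteqP; split=> q /= => [/contrapT|Hq]; [|apply].
have Uyq q : U (y, q) <-> ~ H (q.2 + t (hC, q.1)).
  have -> : (~ H (q.2 + t (hC, q.1))) = xsection U y q by rewrite Uy.
  by rewrite /xsection /= inE.
have nI : ~ I [set z | U (y, (y, h z))].
  have := propertyH1 GLH (hH (- t (hC, y))).
  rewrite (_ : ~` _ = [set z | U (y, (y, h z))]) //.
  apply/seteqP; split=> z /=.
    move=> nz; apply/Uyq => /= Hz; apply: nz; exists (h z + t (hC, y)) => //.
    by rewrite addrK.
  by move=> /Uyq nz [a Ha az]; apply: nz; rewrite /= -az subrK.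
have [z Uz] : exists z, U (y, (y, h z)).
  apply: contrapT => nz; apply: nI; apply: I_subset1 => z z' Uz.
  by case: nz; exists z.
have [|g pg] := phi1 (hC, y).
  by exists (h z); rewrite /xsection /= inE; split=> //; exists z.
have pg' : phi ((hC, y), g).
  have : xsection phi (hC, y) g by rewrite pg.
  by rewrite /xsection /= inE.
have [_ /= /Uyq nH _] := phiA _ pg'.
by apply/nH/EH/PE.
Qed.

End HaarSets.

Theorem theorem13p4 (R : realType) (Z : topologicalType) (I : set (set Z))
    (Gam Lam : setclass) (X : topologicalZmodType)
    (Z_neq0 : [set: Z] !=set0)
    (Z_compact : compact [set: Z])
    (Z_metrizable : metrizable R Z)
    (I_semi_ideal : semi_ideal I)
    (I_cover : \bigcup_(A in I) A = [set: Z])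
    (Gam_pointclass : is_pointclass R Gam)
    (Lam_pointclass : is_pointclass R Lam)
    (IGL_H : propertyH R I Gam Lam)
    (X_polish : polish R X)
    (X_copy : exists e : Z -> X, topological_embedding e)
    (X_nlc : ~ locally_compact [set: X]) :
  exists E : set X,
    [/\ Gam X E, haar1 E, haar I E
      & ~ exists H : set X, [/\ Lam X H, haar I H & E `<=` H]].
Proof.
exact: (haar1_set_without_hull Z_neq0 Z_compact Z_metrizable X_polish
  I_semi_ideal I_cover Gam_pointclass Lam_pointclass IGL_H X_copy X_nlc).
Qed.
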